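(* Assume $d_A\geq d_C$ and $\varepsilon\in(0,1)$. Then $$\textnormal{SC}_{\textnormal{I},H}(\varepsilon, d_A, d_C) = \widetilde{\Omega}\left(\min\left\{\frac{d_A^{3/4}d_C^{1/4}}{\varepsilon}, \frac{d_A^{2/3}d_C^{1/3}}{\varepsilon^{4/3}}\right\}\right).$$
   Context: Independence testing in squared Hellinger distance: given $N$ i.i.d. samples from an unknown distribution $P_{AC}$ on $[d_A]\times[d_C]$ with marginals $P_A,P_C$, a tester must with probability at least $2/3$ correctly decide between $D_H^2(P_{AC},P_AP_C)=0$ and $D_H^2(P_{AC},P_AP_C)\geq\varepsilon$ (any output otherwise), where $D_H^2(P,Q)=\frac12\sum_x(\sqrt{P(x)}-\sqrt{Q(x)})^2$. $\textnormal{SC}_{\textnormal{I},H}(\varepsilon,d_A,d_C)$ is the minimal such $N$. $\widetilde\Omega$ hides poly-logarithmic factors.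
   Formalization: The bound is stated for ε ≤ (1−δ)(1−1/√d_C), for any fixed δ in (0,1), with constants depending on δ; for all ε in (0,1) it is false, as D_H² never exceeds 1−1/√d_C, so SC = 0 for larger ε (e.g. d_C=2, ε=0.9). *)

(* Defs.v *)
From HB Require Import structures.
From mathcomp Require Import all_boot all_order all_algebra.
From mathcomp Require Import all_classical all_reals all_analysis.

Set Implicit Arguments.
Unset Strict Implicit.
Unset Printing Implicit Defensive.

Import Order.TTheory GRing.Theory Num.Theory.
Local Open Scope classical_set_scope.
Local Open Scope ring_scope.

Definition is_dist (R : realType) (T : finType) (P : {ffun T -> R}) : Prop :=
  (forall x, 0 <= P x) /\ \sum_x P x = 1.

Definition marginal1 (R : realType) (A C : finType) (P : {ffun A * C -> R}) :
  {ffun A -> R} := [ffun a => \sum_c P (a, c)].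

Definition marginal2 (R : realType) (A C : finType) (P : {ffun A * C -> R}) :
  {ffun C -> R} := [ffun c => \sum_a P (a, c)].

Definition prod_dist (R : realType) (A C : finType)
    (P : {ffun A -> R}) (Q : {ffun C -> R}) : {ffun A * C -> R} :=
  [ffun x => P x.1 * Q x.2].

Definition hellinger2 (R : realType) (T : finType) (P Q : {ffun T -> R}) : R :=
  2^-1 * \sum_x (Num.sqrt (P x) - Num.sqrt (Q x)) ^+ 2.

Definition dependence (R : realType) (A C : finType) (P : {ffun A * C -> R}) : R :=
  hellinger2 P (prod_dist (marginal1 P) (marginal2 P)).

(* [iid_expect P g] is the expectation of [g] on N independent samples of P. *)
Definition iid_expect (R : realType) (T : finType) (N : nat)
    (P : {ffun T -> R}) (g : N.-tuple T -> R) : R :=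
  \sum_(s : N.-tuple T) (\prod_(i < N) P (tnth s i)) * g s.

(* Testers may be randomized: [t s] is the probability (over the internal
   randomness) of answering "independent" on the sample sequence [s]. *)
Definition is_tester (R : realType) (eps : R) (dA dC N : nat)
    (t : N.-tuple ('I_dA * 'I_dC)%type -> R) : Prop :=
  (forall s, 0 <= t s <= 1) /\
  forall P : {ffun 'I_dA * 'I_dC -> R}, is_dist P ->
    (dependence P = 0 -> 2 / 3 <= iid_expect P t) /\
    (eps <= dependence P -> 2 / 3 <= iid_expect P (fun s => 1 - t s)).

(* The least sample size admitting a tester; +oo if there were none. *)
Definition SC_IH (R : realType) (eps : R) (dA dC : nat) : \bar R :=
  ereal_inf [set (N%:R%:E : \bar R) | N in
    [set N : nat | exists t : N.-tuple ('I_dA * 'I_dC)%type -> R,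
                     is_tester eps t]].

(* The largest value of [dependence] on [dA] x [dC] when 0 < dC <= dA:
   since P(a,c) <= P_A(a),
     1 - D = \sum P(a,c) sqrt (P_A(a) P_C(c) / P(a,c)) >= \sum_c P_C(c)^(3/2)
           >= dC^(-1/2),
   with equality for the uniform distribution on pairs (i,i), i < dC. *)
Definition max_dependence (R : realType) (dC : nat) : R :=
  1 - (Num.sqrt (dC%:R : R))^-1.

Definition SC_rate (R : realType) (eps : R) (dA dC : nat) : R :=
  Num.min (dA%:R `^ (3 / 4) * dC%:R `^ (1 / 4) / eps)
          (dA%:R `^ (2 / 3) * dC%:R `^ (1 / 3) / eps `^ (4 / 3)).

Definition log_factor (R : realType) (eps : R) (dA dC : nat) : R :=
  1 + ln (dA%:R * dC%:R / eps).

(* Main.v *)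
Require Import Defs.
From HB Require Import structures.
From mathcomp Require Import all_boot all_order all_algebra.
From mathcomp Require Import all_classical all_reals all_analysis.
From mathcomp Require Import ring lra.
Import Order.TTheory GRing.Theory Num.Theory.
Local Open Scope ring_scope.

Set Implicit Arguments.
Unset Strict Implicit.
Unset Printing Implicit Defensive.

(* Two random families of distributions are compared.  The rows are grouped into U
   units of q rows, next to a uniform row of mass 1.  Independently, each unit is
   heavy with probability p, carrying mass h = 1/(2N) spread uniformly, or light,
   carrying mass l.  In the null family light units are uniform; in the alternative,
   the columns being cut into K blocks of q, row j of a light unit is concentrated on
   one random column of each block, the j-th cyclic shift of a random column z_b.
   The shifts keep all marginals equal to those of the null family, whose members are
   product distributions.

   Total masses M fluctuate, but tilting the prior by M^N cancels the normalisation of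
   the N-sample likelihood, so that both mixed likelihoods become products over the
   units, as after Poissonisation.  With a the heavy part of the likelihood of a unit, b its
   light part and F the mean effect of the shifts, the chi-square integrand satisfies
     (a + b F)^2 / (a + b) <= a - b + 2 b F + (b^2 / a) (F - 1)^2,
   a signed mixture of N-fold product measures; summing over all samples gives a
   signed expectation of (1 + total mass)^N, which is estimated unit by unit. *)

(** * Signed mixtures of powers *)

Lemma sum_tuple_prod (R : comNzRingType) (X : finType) (N : nat) (F : 'I_N -> X -> R) :
  \sum_(s : N.-tuple X) \prod_(i < N) F i (tnth s i) = \prod_(i < N) \sum_x F i x.
Proof.
rewrite bigA_distr_bigA /=.
rewrite (reindex (fun f : {ffun 'I_N -> X} => [tuple f i | i < N])) /=.
  by apply: eq_bigr => f _; apply: eq_bigr => i _; rewrite tnth_mktuple.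
exists (fun s : N.-tuple X => [ffun i => tnth s i]) => [f _|s _].
  by apply/ffunP => i; rewrite ffunE tnth_mktuple.
by apply: eq_from_tnth => i; rewrite tnth_mktuple ffunE.
Qed.

Lemma sum_ffunS (V : nmodType) (I : finType) (n : nat) (F : {ffun 'I_n.+1 -> I} -> V) :
  \sum_f F f = \sum_x \sum_(g : {ffun 'I_n -> I})
                 F [ffun i => oapp g x (unlift ord0 i)].
Proof.
rewrite pair_big /=.
rewrite (reindex (fun p : I * {ffun 'I_n -> I} =>
                    [ffun i => oapp p.2 p.1 (unlift ord0 i)])) //=.
exists (fun f : {ffun 'I_n.+1 -> I} => (f ord0, [ffun i => f (lift ord0 i)])).
  move=> [x g] _ /=; congr (_, _); first by rewrite ffunE unlift_none.
  by apply/ffunP => i; rewrite !ffunE liftK.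
move=> f _; apply/ffunP => i; rewrite ffunE /=.
by case: unliftP => [j ->|->] //=; rewrite ffunE.
Qed.

Section Mixtures.
Variables (R : realType).

(* [mixpow c m n N t] is the expectation of (t + \sum_u m (x u))^N for
   independent x 0, ..., x (n-1) drawn from the possibly signed weights c. *)
Definition mixpow (I : finType) (c m : I -> R) (n N : nat) (t : R) : R :=
  \sum_(x : {ffun 'I_n -> I}) (\prod_u c (x u)) * (t + \sum_u m (x u)) ^+ N.

Lemma mixpow0 (I : finType) (c m : I -> R) N t : mixpow c m 0 N t = t ^+ N.
Proof.
rewrite /mixpow (eq_bigr (fun _ => t ^+ N)); last first.
  by move=> x _; rewrite !big_ord0 mul1r addr0.
by rewrite sumr_const card_ffun card_ord expn0 mulr1n.
Qed.

Lemma mixpowS (I : finType) (c m : I -> R) n N t :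
  mixpow c m n.+1 N t = \sum_x c x * mixpow c m n N (t + m x).
Proof.
rewrite /mixpow sum_ffunS; apply: eq_bigr => x _.
rewrite mulr_sumr; apply: eq_bigr => g _.
rewrite !big_ord_recl !ffunE unlift_none /= mulrA addrA.
under eq_bigr do rewrite ffunE liftK /=.
by under [X in _ + X]eq_bigr do rewrite ffunE liftK /=.
Qed.

Lemma mixpowS' (I : finType) (c m : I -> R) n N t :
  mixpow c m n.+1 N t =
  \sum_(g : {ffun 'I_n -> I}) (\prod_u c (g u)) *
     \sum_x c x * (t + \sum_u m (g u) + m x) ^+ N.
Proof.
rewrite mixpowS /mixpow; under eq_bigr do rewrite mulr_sumr.
rewrite exchange_big; apply: eq_bigr => g _; rewrite mulr_sumr.
by apply: eq_bigr => x _; rewrite mulrCA addrAC.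
Qed.

(** Expanding in the contribution of one unit leaves only the moments of its weights, multiplied by
    mixed powers for the other units. *)
Lemma mixpow_binomial (I J : finType) (c m : I -> R) (d k : J -> R) n N t :
  \sum_x c x * mixpow d k n N (t + m x) =
  \sum_(r < N.+1) (\sum_x c x * m x ^+ r) * mixpow d k n (N - r) t *+ 'C(N, r).
Proof.
under eq_bigr do rewrite /mixpow mulr_sumr.
rewrite exchange_big /=.
under [RHS]eq_bigr do rewrite /mixpow mulr_sumr -sumrMnl.
rewrite [RHS]exchange_big /=; apply: eq_bigr => g _.
under eq_bigr => x _ do rewrite addrAC exprDn mulr_sumr mulr_sumr.
rewrite exchange_big; apply: eq_bigr => r _ /=.
rewrite mulr_suml -sumrMnl; apply: eq_bigr => x _.
rewrite !mulrnAr; congr (_ *+ _); ring.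
Qed.

(** Units are replaced one at a time. The signed unit split off first has nonnegative moments, so
    the induction hypothesis applies to each binomial term; that unit is then exchanged with the
    others fixed, the base b collecting the mass outside it. *)
Lemma mixpow_le (I J : finType) (c m : I -> R) (d k : J -> R) (X : R) (n N : nat) :
  0 <= X -> (forall x, 0 <= d x) -> (forall x, 0 <= k x) ->
  (forall r, 0 <= \sum_x c x * m x ^+ r) ->
  (forall b r, 1 <= b -> (r <= N)%N ->
     \sum_x c x * (b + m x) ^+ r <= (1 + X) * \sum_x d x * (b + k x) ^+ r) ->
  forall t, 1 <= t -> mixpow c m n N t <= (1 + X) ^+ n * mixpow d k n N t.
Proof.
move=> X0 d0 k0 B0 step t t1.
(* The binomial expansion lowers the exponent, so the induction covers all r <= N. *)
suff H r : (r <= N)%N -> mixpow c m n r t <= (1 + X) ^+ n * mixpow d k n r t.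
  exact: H.
elim: n r => [|n IH] r rN; first by rewrite !mixpow0 mul1r.
rewrite mixpowS mixpow_binomial.
apply: (@le_trans _ _ ((1 + X) ^+ n *
   \sum_(i < r.+1) (\sum_x c x * m x ^+ i) * mixpow d k n (r - i) t *+ 'C(r, i))).
  rewrite mulr_sumr; apply: ler_sum => i _.
  rewrite mulrnAr; apply: ler_wMn2r; rewrite mulrCA; apply: ler_wpM2l => //.
  by apply: IH; apply: leq_trans rN; apply: leq_subr.
rewrite -mixpow_binomial exprSr -mulrA; apply: ler_wpM2l; first by rewrite exprn_ge0// addr_ge0.
rewrite mixpowS' mulr_sumr.
under eq_bigr do rewrite /mixpow mulr_sumr.
rewrite exchange_big; apply: ler_sum => g _ /=.
under eq_bigr do rewrite mulrCA addrAC.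
rewrite -mulr_sumr mulrCA; apply: ler_wpM2l; first exact: prodr_ge0.
apply: step => //; rewrite (le_trans t1)// lerDl.
by apply: sumr_ge0.
Qed.

(** Linearity of expectation under the weights tilted by the N-th power of the total mass: given the
    other units, the tilted probability that one unit satisfies [hv] is at most X. *)
Lemma mixpow_count (I : finType) (d k : I -> R) (hv : pred I) (X : R) (n N : nat) :
  (forall x, 0 <= d x) -> (forall x, 0 <= k x) ->
  (forall b, 1 <= b -> \sum_(x | hv x) d x * (b + k x) ^+ N
                       <= X * \sum_x d x * (b + k x) ^+ N) ->
  forall t, 1 <= t ->
  \sum_(x : {ffun 'I_n -> I}) (\prod_u d (x u)) * (t + \sum_u k (x u)) ^+ N
     * (\sum_u (hv (x u))%:R) <= X *+ n * mixpow d k n N t.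
Proof.
move=> d0 k0 step; elim: n => [|n IH] t t1.
  rewrite mulr0n mul0r big1 // => x _; by rewrite !big_ord0 mulr0.
rewrite sum_ffunS.
have -> : X *+ n.+1 * mixpow d k n.+1 N t =
  \sum_x d x * (X *+ n * mixpow d k n N (t + k x)) +
  X * mixpow d k n.+1 N t.
  rewrite mulrSr mulrDl; congr (_ + _).
  by rewrite mixpowS mulr_sumr; apply: eq_bigr => x _; rewrite mulrCA.
have -> : \sum_x \sum_(g : {ffun 'I_n -> I})
     (\prod_u d ([ffun i => oapp g x (unlift ord0 i)] u) *
     (t + \sum_u k ([ffun i => oapp g x (unlift ord0 i)] u)) ^+ N *
     \sum_u (hv ([ffun i => oapp g x (unlift ord0 i)] u))%:R) =
  \sum_x d x * (\sum_(g : {ffun 'I_n -> I})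
      (\prod_u d (g u)) * (t + k x + \sum_u k (g u)) ^+ N
     * (\sum_u (hv (g u))%:R)) +
  \sum_(g : {ffun 'I_n -> I}) (\prod_u d (g u)) *
     \sum_(x | hv x) d x * (t + \sum_u k (g u) + k x) ^+ N.
  under [X in _ = _ + X]eq_bigr do rewrite mulr_sumr big_mkcond.
  rewrite [X in _ = _ + X]exchange_big -big_split; apply: eq_bigr => x _ /=.
  rewrite mulr_sumr -big_split; apply: eq_bigr => g _ /=.
  rewrite !big_ord_recl !ffunE unlift_none /=.
  under eq_bigr do rewrite ffunE liftK /=.
  under [X in _ + (_ + X)]eq_bigr do rewrite ffunE liftK /=.
  under [X in _ * _ * (_ + X)]eq_bigr do rewrite ffunE liftK /=.
  case: (hv x) => /=; last by rewrite !add0r addr0 !mulrA addrA.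
  rewrite [t + _ + k x]addrAC addrA; ring.
apply: lerD.
  apply: ler_sum => x _; apply: ler_wpM2l => //; apply: IH.
  by rewrite (le_trans t1)// lerDl.
rewrite mixpowS' mulr_sumr; apply: ler_sum => g _.
rewrite mulrCA; apply: ler_wpM2l; first exact: prodr_ge0.
by apply: step; rewrite (le_trans t1)// lerDl; apply: sumr_ge0.
Qed.

End Mixtures.

(** * Mixture likelihoods over independent units *)

Section Likelihoods.
Variables (R : realType) (X : finType) (U N : nat) (o : X -> option 'I_U) (e : X -> R).
Hypothesis e_mass : \sum_(x | o x == None) e x = 1.

(** [o x] is the unit of the cell x; [None] marks the row of mass 1, whose density is e. The measure
    is not normalised. *)
Definition umeasure (g : 'I_U -> X -> R) (x : X) : R :=
  if o x is Some u then g u x else e x.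

(** The value 1 outside the unit u lets the likelihood of any sample factor over the units. *)
Definition ucell (u : 'I_U) (f : X -> R) (x : X) : R :=
  if o x == Some u then f x else 1.

Definition lik (f : X -> R) (s : N.-tuple X) : R := \prod_(i < N) f (tnth s i).

Definition mixlik (I : finType) (c : I -> R) (G : I -> X -> R) (s : N.-tuple X) : R :=
  \sum_(x : {ffun 'I_U -> I}) (\prod_u c (x u)) * lik (umeasure (fun u => G (x u))) s.

Lemma sum_lik f : \sum_s lik f s = (\sum_x f x) ^+ N.
Proof.
by rewrite /lik (sum_tuple_prod (fun=> f)) prodr_const card_ord.
Qed.

Lemma likM f g s : lik (fun x => f x * g x) s = lik f s * lik g s.
Proof. by rewrite /lik -big_split. Qed.

Lemma ucellM u f g : ucell u (fun x => f x * g x) =1 (fun x => ucell u f x * ucell u g x).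
Proof. by move=> x; rewrite /ucell; case: eqP => // _; rewrite mulr1. Qed.

Lemma eq_lik f g s : f =1 g -> lik f s = lik g s.
Proof. by move=> fg; apply: eq_bigr => i _. Qed.

Lemma umeasureE g x :
  umeasure g x = (if o x is Some _ then 1 else e x) * \prod_u ucell u (g u) x.
Proof.
rewrite /umeasure /ucell; case: (o x) => [u|]; last by rewrite big1 ?mulr1.
rewrite mul1r (bigD1 u) //= eqxx big1 ?mulr1 // => v vu.
by rewrite (inj_eq (@Some_inj _)) eq_sym (negbTE vu).
Qed.

(** For fixed samples the likelihood is a product over units, and the units are independent under
    the prior, so distributivity moves the mean inside. *)
Lemma mixlikE (I : finType) (c : I -> R) (G : I -> X -> R) s :
  mixlik c G s = lik (fun x => if o x is Some _ then 1 else e x) s *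
                 \prod_u \sum_x c x * lik (ucell u (G x)) s.
Proof.
rewrite bigA_distr_bigA mulr_sumr; apply: eq_bigr => x _.
rewrite (eq_lik s (umeasureE _)) likM mulrCA; congr (_ * _).
by rewrite big_split /=; congr (_ * _); rewrite /lik exchange_big.
Qed.

Lemma sum_umeasure g m :
  (forall u, \sum_(x | o x == Some u) g u x = m u) ->
  \sum_x umeasure g x = 1 + \sum_u m u.
Proof.
move=> gm; rewrite (partition_big o predT) //= (bigD1 None) //=; congr (_ + _).
  by rewrite -e_mass; apply: eq_bigr => x /eqP ox; rewrite /umeasure ox.
rewrite (reindex_omap Some id) /=; last by case.
rewrite (eq_bigl predT) => [|u]; last by rewrite eqxx.
apply: eq_bigr => u _; rewrite -gm.
by apply: eq_bigr => x /eqP ox; rewrite /umeasure ox.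
Qed.

(** Summing over all samples turns each likelihood into the N-th power of a total mass. *)
Lemma sum_mixlik (I : finType) (c m : I -> R) (G : I -> X -> R) :
  (forall x u, \sum_(y | o y == Some u) G x y = m x) ->
  \sum_s mixlik c G s = mixpow c m U N 1.
Proof.
move=> Gm; rewrite exchange_big; apply: eq_bigr => x _ /=.
by rewrite -mulr_sumr sum_lik (@sum_umeasure _ (fun u => m (x u))).
Qed.

(* Chi-square bound: q^2 / p is a product over units, each factor of which is
   dominated by the signed mixture (c2, G2). *)
Lemma mixlik_dist (I J : finType) (c m : I -> R) (G0 G1 : I -> X -> R)
    (c2 m2 : J -> R) (G2 : J -> X -> R) :
  (forall x, 0 < e x) ->
  (forall x u, \sum_(y | o y == Some u) G0 x y = m x) ->
  (forall x u, \sum_(y | o y == Some u) G1 x y = m x) ->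
  (forall x u, \sum_(y | o y == Some u) G2 x y = m2 x) ->
  (forall u s, 0 < \sum_x c x * lik (ucell u (G0 x)) s) ->
  (forall u s, (\sum_x c x * lik (ucell u (G1 x)) s) ^+ 2 <=
     (\sum_x c x * lik (ucell u (G0 x)) s) * \sum_x c2 x * lik (ucell u (G2 x)) s) ->
  mixpow c2 m2 U N 1 <= (1 + 1 / 100) * mixpow c m U N 1 ->
  \sum_s `|mixlik c G0 s - mixlik c G1 s| <= mixpow c m U N 1 / 10.
Proof.
move=> e0 Gm0 Gm1 Gm2 p0 qp B.
have E0 s : 0 < lik (fun x => if o x is Some _ then 1 else e x) s.
  by apply: prodr_gt0 => i _; case: (o _).
have P0 s : 0 < mixlik c G0 s.
  by rewrite mixlikE mulr_gt0 // prodr_gt0.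
(* This combines |p - q| <= p / 20 + 5 (p - q)^2 / p with (p - q)^2 / p <= b - 2 q + p. Both
   families have the same sum S over the samples, so the total is at most S / 20 + 5 S / 100 = S /
   10. *)
have H s : `|mixlik c G0 s - mixlik c G1 s| <=
    mixlik c G0 s / 20 + 5 * (mixlik c2 G2 s - 2 * mixlik c G1 s + mixlik c G0 s).
  set p := mixlik c G0 s; set q := mixlik c G1 s; set b := mixlik c2 G2 s.
  have p_gt0 : 0 < p by exact: P0.
  have qpb : q ^+ 2 <= p * b.
    rewrite /p /q /b !mixlikE exprMn [leRHS]mulrACA -expr2.
    rewrite ler_wpM2l ?exprn_ge0 ?(ltW (E0 s)) //.
    by rewrite -prodrXl -big_split /=; apply: ler_prod => u _; rewrite sqr_ge0 qp.
  have pqb : (p - q) ^+ 2 <= p * (b - 2 * q + p) by rewrite sqrrB; nra.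
  rewrite -(ler_pM2l p_gt0); set d := `|_|.
  have dE : d ^+ 2 = (p - q) ^+ 2 by rewrite real_normK // num_real.
  have := sqr_ge0 (d - p / 10).
  rewrite -dE in pqb.
  nra.
apply: (le_trans (ler_sum _ (fun s _ => H s))).
rewrite big_split /= -mulr_suml -mulr_sumr !big_split /= sumrN -mulr_sumr.
rewrite (sum_mixlik c Gm0) (sum_mixlik c Gm1) (sum_mixlik c2 Gm2); lra.
Qed.

End Likelihoods.

(** * Shift weights on a unit *)

(** expR u <= 1 / (1 - u), and (1 - u) (1 + u + 2 u^2) = 1 + u^2 (1 - 2 u) >= 1. *)
Lemma expR_le_quadratic (R : realType) (u : R) : u <= 1 / 2 -> expR u <= 1 + u + 2 * u ^+ 2.
Proof.
move=> u2; have := expR_ge1Dx (- u); rewrite expRN => H.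
have u0 := expR_gt0 u.
rewrite -(ler_pM2l (_ : 0 < 1 - u)); last by lra.
apply: (@le_trans _ _ 1); last by nra.
by rewrite -ler_pdivlMr // mul1r.
Qed.

Lemma bernoulli_ge (R : realDomainType) (v : R) r : 0 <= v -> 1 + r%:R * (v - 1) <= v ^+ r.
Proof.
move=> v0; elim: r => [|r IH]; first by rewrite mul0r addr0.
have := ler_wpM2l v0 IH; rewrite -exprS; apply: le_trans.
have : 0 <= r%:R * (v - 1) ^+ 2 by rewrite mulr_ge0 // sqr_ge0.
rewrite -[r.+1%:R]natr1; nra.
Qed.

Section Unit.
Variables (R : realType) (U K q' : nat).
(** The successor form makes 'I_q the cyclic group of order q, in which shifts are added. Row
    [Some (u, j)] is row j of unit u, [None] is the row of mass 1, and column (b, i) is column i of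
    block b. *)
Let q := q'.+1.
Let Cell := (option ('I_U * 'I_q) * ('I_K * 'I_q))%type.
Let Z := {ffun 'I_K -> 'I_q}.
Hypothesis K_gt0 : (0 < K)%N.

Definition unit_of (x : Cell) : option 'I_U := omap fst x.1.

Definition shift_weight (z : Z) (x : Cell) : R :=
  if x.1 is Some (_, j) then q%:R * (x.2.2 == j + z x.2.1)%:R else 1.

(** The inner product of two shift weights under the uniform probability on a unit. For uniform z it
    has mean 1 and variance (q - 1) / K. *)
Definition overlap (z z' : Z) : R := K%:R^-1 * \sum_b q%:R * (z b == z' b)%:R.

(** The number of cells of a unit. *)
Let nn : R := q%:R * (K%:R * q%:R).

Lemma sum_unit (F : Cell -> R) u :
  \sum_(x | unit_of x == Some u) F x =
  \sum_(j < q) \sum_(b < K) \sum_(i < q) F (Some (u, j), (b, i)).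
Proof.
transitivity (\sum_(p | omap fst p == Some u) \sum_y F (p, y)).
  by rewrite pair_big /=; apply: eq_big => [x|x _]; [rewrite andbT | case: x].
rewrite (reindex_omap (fun j : 'I_q => Some (u, j)) (fun p => omap snd p)) /=; last first.
  by case=> [[v j]|] //= /eqP[->].
apply: eq_big => [j|j _]; first by rewrite !eqxx.
by rewrite pair_big /=; apply: eq_bigr => -[].
Qed.

Lemma sum_dump (F : Cell -> R) :
  \sum_(x | unit_of x == None) F x = \sum_(b < K) \sum_(i < q) F (None, (b, i)).
Proof.
transitivity (\sum_(p : option ('I_U * 'I_q) | omap fst p == None) \sum_y F (p, y)).
  by rewrite pair_big /=; apply: eq_big => [x|x _]; [rewrite andbT | case: x].
rewrite (big_pred1 None); last by case.
by rewrite pair_big /=; apply: eq_bigr => -[].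
Qed.

Lemma sum_shift (F : 'I_q -> R) (a : 'I_q) : \sum_(i < q) (i == a)%:R * F i = F a.
Proof.
rewrite (bigD1 a) //= eqxx mul1r big1 ?addr0 // => i /negbTE ->; exact: mul0r.
Qed.

Lemma sum_constr n (a : R) : \sum_(i < n) a = n%:R * a.
Proof. by rewrite sumr_const card_ord mulr_natl. Qed.

Lemma sum_unit_const a u : \sum_(x | unit_of x == Some u) a = nn * a.
Proof. by rewrite sum_unit /nn !(sum_constr, mulrA). Qed.

Lemma sum_unit_shift z a u :
  \sum_(x | unit_of x == Some u) a * shift_weight z x = nn * a.
Proof.
rewrite -mulr_sumr sum_unit /shift_weight /=.
under eq_bigr do under eq_bigr do
  (under eq_bigr do rewrite mulrC; rewrite (sum_shift (fun=> q%:R))).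
rewrite !sum_constr /nn; ring.
Qed.

Lemma sum_unit_shift2 z z' a u :
  \sum_(x | unit_of x == Some u) a * shift_weight z x * shift_weight z' x =
  nn * a * overlap z z'.
Proof.
under eq_bigr do rewrite -mulrA.
rewrite -mulr_sumr sum_unit /shift_weight /=.
have H j b : \sum_(i < q) q%:R * (i == j + z b)%:R * (q%:R * (i == j + z' b)%:R)
   = q%:R * (q%:R * (z b == z' b)%:R) :> R.
  under eq_bigr do rewrite -mulrA mulrCA.
  by rewrite sum_shift (inj_eq (addrI j)).
under eq_bigr do under eq_bigr do rewrite H.
under eq_bigr do rewrite -mulr_sumr.
rewrite sum_constr /overlap /nn.
have : K%:R != 0 :> R by rewrite pnatr_eq0 -lt0n.
by move=> K0; field.
Qed.

Lemma overlapC z z' : overlap z z' = overlap z' z.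
Proof. by rewrite /overlap; under eq_bigr do rewrite eq_sym. Qed.

Lemma overlap_ge0 z z' : 0 <= overlap z z'.
Proof.
by rewrite mulr_ge0 ?invr_ge0 // sumr_ge0 // => b _; rewrite mulr_ge0.
Qed.

Let zeta : R := #|{: Z}|%:R^-1.

Lemma card_shift_neq0 : #|{: Z}|%:R != 0 :> R.
Proof. by rewrite card_ffun !card_ord pnatr_eq0 expn_eq0. Qed.

(** The entries of a uniform z are independent and uniform. *)
Lemma mean_prod (F : 'I_K -> 'I_q -> R) :
  zeta * \sum_(z : Z) \prod_b F b (z b) = \prod_b (q%:R^-1 * \sum_i F b i).
Proof.
rewrite big_split /= prodr_const card_ord bigA_distr_bigA /=; congr (_ * _).
by rewrite /zeta card_ffun !card_ord natrX exprVn.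
Qed.

(** [overlap] minus 1 is an average over independent blocks of centred variables. In each block the
    quadratic bound on expR applies since s q <= K / 2; its linear term has mean zero and its
    quadratic term involves a variance below q. *)
Lemma mean_expR_overlap z' (s : R) :
  0 <= s -> s * q%:R <= K%:R / 2 ->
  zeta * \sum_(z : Z) expR (s * (overlap z z' - 1)) <= expR (2 * s ^+ 2 * q%:R / K%:R).
Proof.
move=> s0 sq.
have K0 : 0 < K%:R :> R by rewrite ltr0n.
have q0 : 0 < q%:R :> R by rewrite ltr0n.
have E z : expR (s * (overlap z z' - 1)) =
    \prod_b expR (s / K%:R * (q%:R * (z b == z' b)%:R - 1)).
  rewrite -expR_sum -mulr_sumr; congr expR.
  rewrite sumrB sum_constr /overlap.
  by field; rewrite gt_eqF.
under eq_bigr do rewrite E.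
rewrite (mean_prod (fun b i => expR (s / K%:R * (q%:R * (i == z' b)%:R - 1)))).
set t := s / K%:R.
have t0 : 0 <= t by rewrite divr_ge0 // ltW.
have tq : t * q%:R <= 1 / 2.
  by rewrite /t mulrAC ler_pdivrMr //; lra.
have step b : q%:R^-1 * \sum_i expR (t * (q%:R * (i == z' b)%:R - 1)) <=
    expR (2 * t ^+ 2 * q%:R).
  apply: (le_trans _ (expR_ge1Dx _)).
  rewrite -(ler_pM2l q0) mulrA divff ?gt_eqF // mul1r.
  apply: (@le_trans _ _ (\sum_i (1 - t + 2 * t ^+ 2 + (i == z' b)%:R *
     (t * q%:R + 2 * t ^+ 2 * q%:R ^+ 2 - 4 * t ^+ 2 * q%:R)))).
    apply: ler_sum => i _; apply: (le_trans (expR_le_quadratic _)).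
      by case: eqP => _ /=; rewrite ?mulr1 ?mulr0; nra.
    by case: eqP => _ /=; rewrite ?mulr1 ?mulr0; nra.
  rewrite big_split /= sum_shift sum_constr.
  have q1 : 1 <= q%:R :> R by rewrite ler1n.
  have := sqr_ge0 t; nra.
apply: (@le_trans _ _ (\prod_(b < K) expR (2 * t ^+ 2 * q%:R))).
  apply: ler_prod => b _; rewrite step andbT mulr_ge0 ?invr_ge0 ?sumr_ge0 //.
rewrite -(expR_sum (index_enum _) predT (fun=> 2 * t ^+ 2 * q%:R)) sum_constr ler_expR /t.
by rewrite le_eqVlt; apply/orP; left; apply/eqP; field; rewrite gt_eqF.
Qed.

Lemma mean_overlap z' : zeta * \sum_(z : Z) overlap z z' = 1.
Proof.
have K0 : K%:R != 0 :> R by rewrite pnatr_eq0 -lt0n.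
have q0 : q%:R != 0 :> R by rewrite pnatr_eq0.
rewrite /overlap -mulr_sumr exchange_big /= mulrCA mulr_sumr.
have H b : zeta * \sum_(z : Z) q%:R * (z b == z' b)%:R = 1.
  (* The factor of block b alone is written as a product over all blocks. *)
  rewrite (eq_bigr (fun z : Z => \prod_c (if c == b then q%:R * (z c == z' c)%:R else 1))).
    rewrite (mean_prod (fun c i => if c == b then q%:R * (i == z' c)%:R else 1)).
    rewrite big1 // => c _; case: eqP => _.
      under eq_bigr do rewrite mulrC.
      by rewrite (sum_shift (fun=> q%:R)) mulVf.
    by rewrite sum_constr mulr1 mulVf.
  move=> z _; rewrite (bigD1 b) //= eqxx big1 ?mulr1 // => c /negbTE -> //.
under eq_bigr do rewrite H.
by rewrite sum_constr mulr1 mulVf.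
Qed.

End Unit.

(** * The hard mixture *)

(** b + t <= b (1 + t) because b >= 1; in the mixtures the row of mass 1 keeps the base at least
    1. *)
Lemma exprD_le_expR (R : realType) (b t : R) n :
  1 <= b -> 0 <= t -> (b + t) ^+ n <= b ^+ n * expR (n%:R * t).
Proof.
move=> b1 t0; rewrite expRM_natl -exprMn.
have b0 : 0 <= b by rewrite (le_trans _ b1).
apply: lerXn2r; rewrite ?nnegrE ?addr_ge0 ?mulr_ge0 ?expR_ge0 //.
apply: (@le_trans _ _ (b * (1 + t))); last by rewrite ler_wpM2l // expR_ge1Dx.
by rewrite mulrDr mulr1 lerD2l ler_peMl.
Qed.

Section HardMixture.
Variables (R : realType) (U K q' N : nat).
Let q := q'.+1.
Let Cell := (option ('I_U * 'I_q) * ('I_K * 'I_q))%type.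
Let Z := {ffun 'I_K -> 'I_q}.
Hypothesis K_gt0 : (0 < K)%N.
Variables (p h l : R).
Hypothesis p01 : 0 < p < 1.
Hypothesis h_gt0 : 0 < h.
Hypothesis l_gt0 : 0 < l.

Let nn : R := q%:R * (K%:R * q%:R).
Let zeta : R := #|{: Z}|%:R^-1.
(** Since (l / nn)^2 / (h / nn) = tau / nn, the term b^2 / a is [kappa] times the likelihood of a
    uniform unit of mass [tau]. *)
Let tau : R := l ^+ 2 / h.
Let kappa : R := (1 - p) ^+ 2 / p.

(** The boolean marks heavy units; they carry a shift pattern too, which their densities ignore. *)
Definition prior (x : bool * Z) : R := (if x.1 then p else 1 - p) * zeta.
Definition unit_mass (x : bool * Z) : R := if x.1 then h else l.
Definition null_density (x : bool * Z) (c : Cell) : R := unit_mass x / nn.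
Definition alt_density (x : bool * Z) (c : Cell) : R :=
  if x.1 then h / nn else l / nn * shift_weight R x.2 c.

(* The six terms of [a - b + 2 b F + (b^2 / a) (F^2 - 2 F + 1)], in this order. *)
Definition chi_weight (x : 'I_6 * (Z * Z)) : R :=
  (match val x.1 with
   | 0%N => p | 1%N => - (1 - p) | 2%N => 2 * (1 - p)
   | 3%N => kappa | 4%N => - (2 * kappa) | _ => kappa
   end) * zeta ^+ 2.

(** F^2 is a mean over two independent patterns z and z', whence the pair in the index. *)
Definition chi_mass (x : 'I_6 * (Z * Z)) : R :=
  match val x.1 with
  | 0%N => h | 1%N => l | 2%N => l | 3%N => tau * overlap R x.2.1 x.2.2 | _ => tau
  end.

Definition chi_density (x : 'I_6 * (Z * Z)) (c : Cell) : R :=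
  match val x.1 with
  | 0%N => h / nn
  | 1%N => l / nn
  | 2%N => l / nn * shift_weight R x.2.1 c
  | 3%N => tau / nn * shift_weight R x.2.1 c * shift_weight R x.2.2 c
  | 4%N => tau / nn * shift_weight R x.2.1 c
  | _ => tau / nn
  end.

Let K0 : 0 < K%:R :> R. Proof. by rewrite ltr0n. Qed.
Let q0 : 0 < q%:R :> R. Proof. by rewrite ltr0n. Qed.
Let nn0 : 0 < nn. Proof. by rewrite !mulr_gt0. Qed.
Let p0 : 0 < p. Proof. by case/andP: p01. Qed.
Let p1 : 0 < 1 - p. Proof. by rewrite subr_gt0; case/andP: p01. Qed.
Let tau0 : 0 < tau. Proof. by rewrite divr_gt0 ?exprn_gt0. Qed.
Let kappa0 : 0 < kappa. Proof. by rewrite divr_gt0 ?exprn_gt0. Qed.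
Let zeta0 : 0 < zeta.
Proof. by rewrite invr_gt0 lt0r (card_shift_neq0 R K q') ler0n. Qed.

Lemma mean_const (a : R) : zeta * \sum_(z : Z) a = a.
Proof.
by rewrite sumr_const -mulr_natl mulrA mulVf ?mul1r // (card_shift_neq0 R K q').
Qed.

Lemma sum_prior (F : bool * Z -> R) :
  \sum_x prior x * F x =
  p * (zeta * \sum_z F (true, z)) + (1 - p) * (zeta * \sum_z F (false, z)).
Proof.
transitivity (\sum_b \sum_z prior (b, z) * F (b, z)).
  by rewrite pair_big; apply: eq_bigr => -[].
by rewrite big_bool /prior /= !mulr_sumr; congr (_ + _); apply: eq_bigr => z _;
   rewrite mulrA.
Qed.

Lemma sum_prior_mass (phi : R -> R) :
  \sum_x prior x * phi (unit_mass x) = p * phi h + (1 - p) * phi l.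
Proof. by rewrite (sum_prior (phi \o unit_mass)) /unit_mass /= !mean_const. Qed.

Lemma sum_chi (F : 'I_6 * (Z * Z) -> R) :
  let mean k := zeta * \sum_(z : Z) (zeta * \sum_(z' : Z) F (inord k, (z, z'))) in
  \sum_x chi_weight x * F x =
  p * mean 0%N - (1 - p) * mean 1%N + 2 * (1 - p) * mean 2%N
  + kappa * (mean 3%N - 2 * mean 4%N + mean 5%N).
Proof.
have E k : zeta * \sum_(z : Z) (zeta * \sum_(z' : Z) F (inord k, (z, z'))) =
   zeta ^+ 2 * \sum_z F (inord k, z).
  rewrite -mulr_sumr mulrA -expr2; congr (_ * _); rewrite pair_big /=.
  by apply: eq_bigr => -[].
move=> mean; rewrite /mean !E.
transitivity (\sum_(k < 6) \sum_z chi_weight (inord k, z) * F (inord k, z)).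
  by rewrite pair_big; apply: eq_bigr => -[k z] _ /=; rewrite inord_val.
rewrite !big_ord_recr big_ord0 /= add0r.
rewrite /chi_weight /= !inordK // -!mulr_sumr; ring.
Qed.

(** The terms - b and 2 b F have equal masses and together restore the null mean; what is left is
    the effect of the fluctuation of the overlap about its mean 1. *)
Lemma sum_chi_mass (phi : R -> R) :
  \sum_x chi_weight x * phi (chi_mass x) =
  p * phi h + (1 - p) * phi l +
  kappa * (zeta * \sum_(z : Z) (zeta * \sum_(z' : Z) phi (tau * overlap R z z')) - phi tau).
Proof.
rewrite (sum_chi (phi \o chi_mass)) /= /chi_mass /= !inordK //= !mean_const.
ring.
Qed.

Lemma sum_null_density x u :
  \sum_(c | unit_of c == Some u) null_density x c = unit_mass x.
Proof.
by rewrite (sum_unit_const K q' _ u) mulrC divfK // gt_eqF.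
Qed.

Lemma sum_alt_density x u :
  \sum_(c | unit_of c == Some u) alt_density x c = unit_mass x.
Proof.
rewrite /alt_density /unit_mass; case: x.1.
  by rewrite (sum_unit_const K q' _ u) mulrC divfK // gt_eqF.
by rewrite sum_unit_shift mulrC divfK // gt_eqF.
Qed.

Lemma sum_chi_density x u :
  \sum_(c | unit_of c == Some u) chi_density x c = chi_mass x.
Proof.
have E a : nn * (a / nn) = a by rewrite mulrC divfK // gt_eqF.
rewrite /chi_density /chi_mass.
case: x => [[[|[|[|[|[|k]]]]] ?] [z z']] /=;
  by rewrite ?sum_unit_shift2 // ?sum_unit_shift ?(sum_unit_const K q' _ u) E.
Qed.

(** By Bernoulli's inequality and its mean 1, [overlap] has mean r-th power at least 1, so the
    [kappa] term is nonnegative. This is what the exchange unit by unit asks of signed weights. *)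
Lemma chi_moment_ge0 r : 0 <= \sum_x chi_weight x * chi_mass x ^+ r.
Proof.
rewrite (sum_chi_mass (fun t => t ^+ r)).
have H : 1 <= zeta * \sum_(z : Z) (zeta * \sum_(z' : Z) overlap R z z' ^+ r).
  rewrite -[leLHS]mean_const ler_pM2l //; apply: ler_sum => z _.
  under eq_bigr => z' _ do rewrite overlapC.
  apply: (@le_trans _ _ (zeta * \sum_(z' : Z) (1 + r%:R * (overlap R z' z - 1)))).
    rewrite big_split /= mulrDr mean_const -mulr_sumr sumrB mulrCA mulrBr.
    by rewrite mean_overlap // mean_const subrr mulr0 addr0.
  by rewrite ler_pM2l //; apply: ler_sum => z' _; apply/bernoulli_ge/overlap_ge0.
apply: addr_ge0; first by rewrite addr_ge0 ?mulr_ge0 ?exprn_ge0 // ltW.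
apply: mulr_ge0; first exact: ltW.
under eq_bigr do under eq_bigr do rewrite exprMn.
under eq_bigr do rewrite -mulr_sumr mulrCA.
rewrite -mulr_sumr mulrCA -[X in _ - X]mulr1 -mulrBr.
by rewrite mulr_ge0 ?exprn_ge0 ?subr_ge0 // ltW.
Qed.

(** With a, b and F of the unit, the right side exceeds (a + b F)^2 by b^3 (F - 1)^2 / a. *)
Lemma unit_chi_bound (s : N.-tuple Cell) u :
  (\sum_x prior x * lik (ucell (@unit_of U K q') u (alt_density x)) s) ^+ 2 <=
  (\sum_x prior x * lik (ucell (@unit_of U K q') u (null_density x)) s) *
   \sum_x chi_weight x * lik (ucell (@unit_of U K q') u (chi_density x)) s.
Proof.
set A := lik (ucell (@unit_of U K q') u (fun=> h / nn)) s.
set L := lik (ucell (@unit_of U K q') u (fun=> l / nn)) s.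
set T := lik (ucell (@unit_of U K q') u (fun=> tau / nn)) s.
pose W z := lik (ucell (@unit_of U K q') u (shift_weight R z)) s.
have lik_mul f g : lik (ucell (@unit_of U K q') u (fun x => f x * g x)) s =
    lik (ucell (@unit_of U K q') u f) s * lik (ucell (@unit_of U K q') u g) s.
  by rewrite (eq_lik s (ucellM (@unit_of U K q') u f g)) likM.
set F := zeta * \sum_(z : Z) W z.
have A0 : 0 < A.
  by apply: prodr_gt0 => i _; rewrite /ucell; case: ifP; rewrite ?divr_gt0.
(* The choice of [tau] makes L the geometric mean of A and T. *)
have TA : T * A = L ^+ 2.
  rewrite /T /A expr2 -!likM; apply: eq_lik => x; rewrite /ucell.
  by case: ifP => // _; rewrite /tau; field; rewrite !gt_eqF.
have L0 : 0 <= L.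
  by apply: prodr_ge0 => i _; rewrite /ucell; case: ifP; rewrite ?divr_ge0 ?ltW.
have -> : \sum_x prior x * lik (ucell (@unit_of U K q') u (null_density x)) s = p * A + (1 - p) * L.
  rewrite (sum_prior (fun x => lik (ucell (@unit_of U K q') u (null_density x)) s)).
  by rewrite /null_density /unit_mass /= !mean_const.
have -> : \sum_x prior x * lik (ucell (@unit_of U K q') u (alt_density x)) s =
    p * A + (1 - p) * L * F.
  rewrite (sum_prior (fun x => lik (ucell (@unit_of U K q') u (alt_density x)) s)).
  rewrite /alt_density /= mean_const.
  congr (_ + _); rewrite -mulrA; congr (_ * _).
  rewrite /F mulrCA; congr (_ * _); rewrite mulr_sumr; apply: eq_bigr => z _.
  by rewrite -lik_mul.
have -> : \sum_x chi_weight x * lik (ucell (@unit_of U K q') u (chi_density x)) s =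
    p * A - (1 - p) * L + 2 * (1 - p) * (L * F) + kappa * T * (F - 1) ^+ 2.
  rewrite (sum_chi (fun x => lik (ucell (@unit_of U K q') u (chi_density x)) s)) /=.
  have W1 a z : lik (ucell (@unit_of U K q') u (fun c => a * shift_weight R z c)) s =
     lik (ucell (@unit_of U K q') u (fun=> a)) s * W z by rewrite lik_mul.
  rewrite /chi_density /= !inordK //= !mean_const.
  under eq_bigr do rewrite mean_const W1.
  under [X in kappa * (zeta * X - _ + _)]eq_bigr do
    (under eq_bigr do rewrite lik_mul W1; rewrite -mulr_sumr mulrCA).
  under [X in kappa * (_ - 2 * (zeta * X) + _)]eq_bigr do rewrite mean_const W1.
  rewrite -/A -/L -/T -!mulr_sumr -mulr_suml -mulr_sumr -/(W _) -/F.
  rewrite /F; ring.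
set a := p * A; set b := (1 - p) * L; set d := b * (F - 1).
have a0 : 0 < a by rewrite mulr_gt0.
have b0 : 0 <= b by rewrite mulr_ge0 // ltW.
have kT : kappa * T = b ^+ 2 / a.
  rewrite /b /a exprMn -TA /kappa; field; by rewrite !gt_eqF.
rewrite kT.
have -> : (a + b) * (a - b + 2 * (1 - p) * (L * F) + b ^+ 2 / a * (F - 1) ^+ 2) =
   (a + b * F) ^+ 2 + b * (d ^+ 2 / a).
  by rewrite /d /b; field; rewrite gt_eqF.
by rewrite lerDl mulr_ge0 // divr_ge0 ?sqr_ge0 // ltW.
Qed.

Lemma unit_null_gt0 (s : N.-tuple Cell) u :
  0 < \sum_x prior x * lik (ucell (@unit_of U K q') u (null_density x)) s.
Proof.
have prior_gt0 x : 0 < prior x by rewrite mulr_gt0 //; case: x.1.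
have lik_gt0 x : 0 < lik (ucell (@unit_of U K q') u (null_density x)) s.
  apply: prodr_gt0 => i _; rewrite /ucell; case: ifP => // _.
  by rewrite divr_gt0 // /unit_mass; case: x.1.
rewrite (bigD1 (true, [ffun=> ord0])) //= ltr_pwDl ?mulr_gt0 //.
by apply: sumr_ge0 => x _; rewrite mulr_ge0 // ltW.
Qed.

Let x : R := N%:R * tau.
Let x0 : 0 <= x. Proof. by rewrite mulr_ge0 // ltW. Qed.
Hypothesis x_small : x * q%:R <= 1 / 2.

(** Divided by (b + tau)^r, the mean power is at most the mean of expR (s (overlap - 1)) with s <=
    x. The exponential moment bound makes this at most expR y <= 1 + 2 y. *)
Lemma overlap_power_bound (b : R) r : 1 <= b -> (r <= N)%N ->
  zeta * \sum_(z : Z) (zeta * \sum_(z' : Z) (b + tau * overlap R z z') ^+ r)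
    - (b + tau) ^+ r <= 8 * x ^+ 2 * q%:R / K%:R * b ^+ r.
Proof.
move=> b1 rN.
have b0 : 0 < b by lra.
have bt0 : 0 < b + tau by rewrite addr_gt0.
have K1 : 1 <= K%:R :> R by rewrite ler1n.
have q1 : 1 <= q%:R :> R by rewrite ler1n.
have x2 : x <= 1 / 2 by rewrite (le_trans _ x_small) // ler_peMr.
set s := r%:R * (tau / (b + tau)).
have s0 : 0 <= s by rewrite mulr_ge0 // divr_ge0 // ltW.
have sx : s <= x.
  rewrite /s /x; apply: ler_pM; rewrite ?ler0n ?ler_nat //; first by rewrite divr_ge0 // ltW.
  by rewrite ler_pdivrMr // ler_peMr ?(ltW tau0) //; have := tau0; lra.
set y := 2 * x ^+ 2 * q%:R / K%:R.
have y0 : 0 <= y.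
  apply: divr_ge0 => //; rewrite -mulrA.
  by apply: mulr_ge0 => //; apply: mulr_ge0 => //; exact: sqr_ge0.
have y2 : y <= 1 / 2.
  rewrite /y ler_pdivrMr //; apply: (@le_trans _ _ (1 / 2)); last by lra.
  by have := ler_wpM2l x0 x_small; rewrite expr2; lra.
have mean_le z : zeta * \sum_(z' : Z) (b + tau * overlap R z z') ^+ r <=
    (b + tau) ^+ r * (1 + 2 * y).
  apply: (@le_trans _ _ ((b + tau) ^+ r * (zeta * \sum_z' expR (s * (overlap R z' z - 1))))).
    rewrite mulrCA ler_pM2l // mulr_sumr; apply: ler_sum => z' _.
    rewrite overlapC /s -mulrA expRM_natl -exprMn; apply: lerXn2r; rewrite ?nnegrE.
    - by rewrite addr_ge0 ?(ltW b0) // mulr_ge0 ?(ltW tau0) // overlap_ge0.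
    - by rewrite mulr_ge0 ?expR_ge0 ?(ltW bt0).
    rewrite (le_trans _ (ler_wpM2l (ltW bt0) (expR_ge1Dx _))) //.
    by rewrite le_eqVlt; apply/orP; left; apply/eqP; field; rewrite gt_eqF.
  rewrite ler_pM2l ?exprn_gt0 //.
  have sq : s * q%:R <= K%:R / 2.
    have sq' : s * q%:R <= x * q%:R by rewrite ler_pM2r.
    apply: (le_trans sq'); apply: (le_trans x_small); lra.
  apply: (le_trans (mean_expR_overlap K_gt0 _ s0 sq)).
  apply: (@le_trans _ _ (expR y)).
    rewrite ler_expR /y ler_pM2r ?invr_gt0 // ler_pM2r // ler_pM2l //.
    by rewrite lerXn2r ?nnegrE.
  apply: (le_trans (expR_le_quadratic y2)); nra.
(* Replacing b + tau by b costs a factor 2, since x <= 1/2. *)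
have pow_le : (b + tau) ^+ r <= 2 * b ^+ r.
  apply: (le_trans (exprD_le_expR r b1 (ltW tau0))).
  rewrite mulrC ler_pM2r ?exprn_gt0 //.
  apply: (@le_trans _ _ (expR x)).
    by rewrite ler_expR ler_pM2r // ler_nat.
  by apply: (le_trans (expR_le_quadratic x2)); rewrite expr2; nra.
apply: (@le_trans _ _ ((b + tau) ^+ r * (1 + 2 * y) - (b + tau) ^+ r)).
  rewrite lerD2r -[leRHS]mean_const ler_pM2l //.
  by apply: ler_sum => z _; apply: mean_le.
have -> : 8 * x ^+ 2 * q%:R / K%:R = 4 * y by rewrite /y; field; rewrite gt_eqF.
nra.
Qed.

(** The null mean of (b + mass)^r is at least b^r, so the overlap excess is a relative error;
    [kappa] is at most 1 / p. *)
Lemma mixpow_chi_le :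
  mixpow chi_weight chi_mass U N 1 <=
  (1 + 8 * x ^+ 2 * q%:R / (p * K%:R)) ^+ U * mixpow prior unit_mass U N 1.
Proof.
apply: mixpow_le => //.
- apply: divr_ge0; last by rewrite mulr_ge0 // ltW.
  by rewrite -mulrA; apply: mulr_ge0 => //; apply: mulr_ge0 => //; exact: sqr_ge0.
- by move=> y; rewrite mulr_ge0 ?ltW //; case: y.1.
- by move=> y; rewrite /unit_mass; case: y.1; rewrite ltW.
- exact: chi_moment_ge0.
move=> b r b1 rN.
rewrite (sum_chi_mass (fun t => (b + t) ^+ r)) (sum_prior_mass (fun t => (b + t) ^+ r)).
have b0 : 0 <= b by lra.
set P := p * _ + _.
have bP : b ^+ r <= P.
  have H1 : b ^+ r <= (b + h) ^+ r by rewrite lerXn2r ?nnegrE ?addr_ge0 ?lerDl // ltW.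
  have H2 : b ^+ r <= (b + l) ^+ r by rewrite lerXn2r ?nnegrE ?addr_ge0 ?lerDl // ltW.
  have := ler_wpM2l (ltW p0) H1; have := ler_wpM2l (ltW p1) H2; rewrite /P; lra.
rewrite mulrDl mul1r lerD2l.
apply: (le_trans (ler_wpM2l (ltW kappa0) (overlap_power_bound b1 rN))).
have -> : 8 * x ^+ 2 * q%:R / (p * K%:R) = p^-1 * (8 * x ^+ 2 * q%:R / K%:R).
  by field; rewrite !gt_eqF.
set Y := _ / K%:R.
have Y0 : 0 <= Y.
  apply: divr_ge0 => //; rewrite -mulrA.
  by apply: mulr_ge0 => //; apply: mulr_ge0 => //; exact: sqr_ge0.
have kp : kappa <= p^-1.
  rewrite /kappa ler_pdivrMr // mulVf ?gt_eqF // expr_le1 ?(ltW p1) //.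
  by rewrite gerBl ltW.
rewrite -[leRHS]mulrA; apply: ler_pM => //.
  exact: (ltW kappa0).
  by rewrite mulr_ge0 // exprn_ge0.
by rewrite ler_wpM2l.
Qed.

Hypothesis h_small : N%:R * h <= 1 / 2.

(** As N h <= 1/2, tilting by the N-th power of the mass at most doubles the probability of a heavy
    unit. *)
Lemma prior_heavy_count :
  \sum_(y : {ffun 'I_U -> bool * Z}) (\prod_u prior (y u)) * (1 + \sum_u unit_mass (y u)) ^+ N
     * (\sum_u ((y u).1)%:R) <= (2 * p) *+ U * mixpow prior unit_mass U N 1.
Proof.
apply: (@mixpow_count _ _ prior unit_mass (fun y => y.1)) => //.
- by move=> y; rewrite mulr_ge0 ?ltW //; case: y.1.
- by move=> y; rewrite /unit_mass; case: y.1; rewrite ltW.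
move=> b b1; have b0 : 0 < b by lra.
rewrite (sum_prior_mass (fun t => (b + t) ^+ N)).
have -> : \sum_(y | y.1) prior y * (b + unit_mass y) ^+ N = p * (b + h) ^+ N.
  rewrite big_mkcond.
  transitivity (\sum_y prior y * (if y.1 then (b + unit_mass y) ^+ N else 0)).
    by apply: eq_bigr => y _; case: y.1; rewrite ?mulr0.
  rewrite (sum_prior (fun y => if y.1 then (b + unit_mass y) ^+ N else 0)).
  by rewrite /unit_mass /= !mean_const mulr0 addr0.
have bh : (b + h) ^+ N <= 2 * b ^+ N.
  apply: (le_trans (exprD_le_expR N b1 (ltW h_gt0))).
  rewrite mulrC ler_pM2r ?exprn_gt0 //.
  apply: (le_trans (expR_le_quadratic h_small)).
  have : 0 <= N%:R * h by rewrite mulr_ge0 // ltW.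
  move: h_small; generalize (N%:R * h) => y; rewrite expr2; nra.
have H1 : b ^+ N <= (b + h) ^+ N by rewrite lerXn2r ?nnegrE ?addr_ge0 ?lerDl // ltW.
have H2 : b ^+ N <= (b + l) ^+ N by rewrite lerXn2r ?nnegrE ?addr_ge0 ?lerDl // ltW.
rewrite [2 * p]mulrC -mulrA ler_pM2l // (le_trans bh) // ler_pM2l //.
have := ler_wpM2l (ltW p0) H1; have := ler_wpM2l (ltW p1) H2; lra.
Qed.

End HardMixture.

(** * Embedding small alphabets *)

Lemma iid_expect_compl (R : realType) (T : finType) N (P : {ffun T -> R}) (t : N.-tuple T -> R) :
  is_dist P -> iid_expect P (fun s => 1 - t s) = 1 - iid_expect P t.
Proof.
move=> [_ P1]; rewrite /iid_expect; under eq_bigr do rewrite mulrBr mulr1.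
by rewrite sumrB (sum_tuple_prod (fun=> P)) prodr_const card_ord P1 expr1n.
Qed.

Lemma iid_expect_ge0 (R : realType) (T : finType) N (P : {ffun T -> R}) (t : N.-tuple T -> R) :
  is_dist P -> (forall s, 0 <= t s) -> 0 <= iid_expect P t.
Proof.
by move=> [P0 _] t0; apply: sumr_ge0 => s _; rewrite mulr_ge0 // prodr_ge0.
Qed.

Section Push.
Variables (R : realType) (X Y : finType) (F : X -> Y).

Definition push (P : {ffun X -> R}) : {ffun Y -> R} := [ffun y => \sum_(x | F x == y) P x].

Lemma is_dist_push P : is_dist P -> is_dist (push P).
Proof.
move=> [P0 P1]; split=> [y|]; first by rewrite ffunE sumr_ge0.
rewrite -P1 [RHS](partition_big F predT) //=.
by apply: eq_bigr => y _; rewrite ffunE.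
Qed.

Lemma iid_expect_push N (P : {ffun X -> R}) (t : N.-tuple Y -> R) :
  iid_expect (push P) t = iid_expect P (fun s => t (map_tuple F s)).
Proof.
rewrite /iid_expect.
(* A sequence r is summed jointly with its image s, by inserting the indicator that F maps r to
   s. *)
transitivity (\sum_(s : N.-tuple Y) \sum_(r : N.-tuple X)
    (\prod_(i < N) (F (tnth r i) == tnth s i)%:R) * (\prod_(i < N) P (tnth r i)) * t s).
  apply: eq_bigr => s _; rewrite -mulr_suml; congr (_ * _).
  under [RHS]eq_bigr do rewrite -big_split /=.
  rewrite (sum_tuple_prod (fun i x => (F x == tnth s i)%:R * P x)).
  apply: eq_bigr => i _; rewrite ffunE big_mkcond; apply: eq_bigr => x _.
  by case: eqP => _; rewrite ?mul1r ?mul0r.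
rewrite exchange_big; apply: eq_bigr => r _.
rewrite (bigD1 (map_tuple F r)) //= [X in _ + X]big1 ?addr0.
  by rewrite big1 ?mul1r // => i _; rewrite tnth_map eqxx.
move=> s sr; suff [i ri] : exists i, F (tnth r i) != tnth s i.
  by rewrite (bigD1 i) //= (negbTE ri) !mul0r.
apply/existsP; apply: contraNT sr; rewrite negb_exists => /forallP H.
apply/eqP/eq_from_tnth => i; rewrite tnth_map.
by have := H i; rewrite negbK => /eqP.
Qed.

Hypothesis F_inj : injective F.

Lemma pushE P x : push P (F x) = P x.
Proof.
by rewrite ffunE (big_pred1 x) // => z; rewrite (inj_eq F_inj).
Qed.

Lemma hellinger2_push P Q : hellinger2 (push P) (push Q) = hellinger2 P Q.
Proof.
rewrite /hellinger2; congr (_ * _).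
rewrite [RHS](partition_big F predT) //=; apply: eq_bigr => y _.
case: (pickP (fun x => F x == y)) => [x /eqP <-|H].
  rewrite !pushE (big_pred1 x) // => z; by rewrite (inj_eq F_inj).
by rewrite !ffunE !(big_pred0 _ _ _ _ H) subrr expr0n.
Qed.

End Push.

Lemma push_comp (R : realType) (X Y W : finType) (F : X -> Y) (G : Y -> W) (P : {ffun X -> R}) :
  push G (push F P) = push (G \o F) P.
Proof.
apply/ffunP => w; rewrite !ffunE [RHS](partition_big F (fun y => G y == w)) //=.
apply: eq_bigr => y /eqP <-; rewrite ffunE; apply: eq_bigl => x.
by case: (F x =P y) => [->|]; rewrite ?eqxx ?andbF.
Qed.

Lemma marginal1_push (R : realType) (A C : finType) (P : {ffun A * C -> R}) :
  marginal1 P = push fst P.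
Proof.
apply/ffunP => a; rewrite !ffunE.
rewrite (reindex_omap (fun c => (a, c)) (fun x => Some x.2)) /=.
  by apply: eq_bigl => c; rewrite !eqxx.
by move=> [a' c] /= /eqP <-.
Qed.

Lemma marginal2_push (R : realType) (A C : finType) (P : {ffun A * C -> R}) :
  marginal2 P = push snd P.
Proof.
apply/ffunP => c; rewrite !ffunE.
rewrite (reindex_omap (fun a => (a, c)) (fun x => Some x.1)) /=.
  by apply: eq_bigl => a; rewrite !eqxx.
by move=> [a c'] /= /eqP <-.
Qed.

(** Marginals and their product are transported along the relabelling, and cells outside its image
    have mass zero in both distributions. *)
Lemma dependence_push (R : realType) (A C A' C' : finType) (f : A -> A') (g : C -> C')
    (P : {ffun A * C -> R}) :
  injective f -> injective g ->
  dependence (push (fun x => (f x.1, g x.2)) P) = dependence P.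
Proof.
move=> fI gI; set F := fun x => _.
have FI : injective F by move=> [a c] [a' c'] [/fI -> /gI ->].
rewrite /dependence -(hellinger2_push FI); congr hellinger2.
have -> : marginal1 (push F P) = push f (marginal1 P).
  by rewrite !marginal1_push !push_comp.
have -> : marginal2 (push F P) = push g (marginal2 P).
  by rewrite !marginal2_push !push_comp.
apply/ffunP => -[a c]; rewrite !ffunE /= mulr_suml.
under [LHS]eq_bigr do rewrite mulr_sumr.
rewrite pair_big /=; apply: eq_big => [x|x _]; first by rewrite /F xpair_eqE.
by rewrite [RHS]ffunE.
Qed.

(** The tester is run on relabelled samples. Hard instances can then live on structured types that
    fit in the given alphabets. *)
Lemma is_tester_embed (R : realType) (eps : R) dA dC N
    (t : N.-tuple ('I_dA * 'I_dC)%type -> R) (A C : finType) :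
  is_tester eps t -> (#|A| <= dA)%N -> (#|C| <= dC)%N ->
  exists t' : N.-tuple (A * C)%type -> R, (forall s, 0 <= t' s <= 1) /\
    forall P : {ffun A * C -> R}, is_dist P ->
    (dependence P = 0 -> 2 / 3 <= iid_expect P t') /\
    (eps <= dependence P -> 2 / 3 <= iid_expect P (fun s => 1 - t' s)).
Proof.
move=> [t01 tP] cA cC.
pose f a := widen_ord cA (enum_rank a); pose g c := widen_ord cC (enum_rank c).
have fI : injective f by move=> a b /(congr1 val) /= /ord_inj /enum_rank_inj.
have gI : injective g by move=> a b /(congr1 val) /= /ord_inj /enum_rank_inj.
pose F (x : A * C) := (f x.1, g x.2).
exists (fun s => t (map_tuple F s)); split=> [s|P dP]; first exact: t01.
have [H0 H1] := tP _ (is_dist_push F dP).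
by rewrite dependence_push // !iid_expect_push in H0 H1.
Qed.

(** * Dependence of the hard instances *)

Section HardInstances.
Variables (R : realType) (U K q' : nat).
Let q := q'.+1.
Let Cell := (option ('I_U * 'I_q) * ('I_K * 'I_q))%type.
Let Z := {ffun 'I_K -> 'I_q}.
Hypothesis K_gt0 : (0 < K)%N.
Variables (h l : R).
Hypothesis h_gt0 : 0 < h.
Hypothesis l_gt0 : 0 < l.

Let nn : R := q%:R * (K%:R * q%:R).
Let K0 : 0 < K%:R :> R. Proof. by rewrite ltr0n. Qed.
Let q0 : 0 < q%:R :> R. Proof. by rewrite ltr0n. Qed.
Let nn0 : 0 < nn. Proof. by rewrite !mulr_gt0. Qed.
Let mass_ge0 (x : bool * Z) : 0 <= unit_mass h l x.
Proof. by rewrite /unit_mass; case: x.1; rewrite ltW. Qed.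

Let dump (c : Cell) : R := (K%:R * q%:R)^-1.

Definition instance_measure (G : bool * Z -> Cell -> R) (x : {ffun 'I_U -> bool * Z}) : Cell -> R :=
  umeasure (@unit_of U K q') dump (fun u => G (x u)).

Definition total_mass (x : {ffun 'I_U -> bool * Z}) : R := 1 + \sum_u unit_mass h l (x u).

Definition instance_dist G x : {ffun Cell -> R} :=
  [ffun c => instance_measure G x c / total_mass x].

Lemma total_mass_gt0 x : 0 < total_mass x.
Proof. by rewrite ltr_wpDr ?sumr_ge0. Qed.

Lemma dump_mass : \sum_(c | unit_of c == None) dump c = 1.
Proof. by rewrite sum_dump /dump !sum_constr mulrA mulfV // gt_eqF ?mulr_gt0. Qed.

(** Row and column sums within each unit are those of the uniform density of the same mass; this
    determines both marginals of an instance. *)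
Definition balanced (G : bool * Z -> Cell -> R) :=
  (forall x c, 0 <= G x c) /\
  (forall x u (j : 'I_q), \sum_y G x (Some (u, j), y) = unit_mass h l x / q%:R) /\
  (forall x (u : 'I_U) y, \sum_j G x (Some (u, j), y) = unit_mass h l x / (K%:R * q%:R)).

Lemma balanced_null : balanced (null_density h l).
Proof.
split; first by move=> x c; rewrite divr_ge0 // ltW.
split=> x u y; rewrite sumr_const ?card_prod !card_ord /null_density.
  by rewrite -[LHS]mulr_natr natrM -/q; field; rewrite !gt_eqF.
by rewrite -[LHS]mulr_natr -/q; field; rewrite !gt_eqF.
Qed.

Lemma balanced_alt : balanced (alt_density h l).
Proof.
have [n0 [n1 n2]] := balanced_null.
split.
  have a0 a : 0 < a -> 0 <= a / nn by move=> a_gt0; rewrite ltW // divr_gt0.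
  move=> x c; rewrite /alt_density; case: x.1; first exact: a0.
  apply: mulr_ge0; first exact: a0.
  by rewrite /shift_weight; case: c.1 => [[_ j]|] //; rewrite mulr_ge0.
split=> x u y; rewrite /alt_density /unit_mass; case: ifP => x1.
- by rewrite -(n1 (true, x.2) u y).
- rewrite -mulr_sumr.
  transitivity (l / nn * \sum_(b < K) \sum_(i < q) shift_weight R x.2 (Some (u, y), (b, i))).
    by rewrite pair_big; congr (_ * _); apply: eq_bigr => -[].
  rewrite /shift_weight /=.
  under eq_bigr do (under eq_bigr do rewrite mulrC; rewrite (sum_shift (fun=> q%:R))).
  by rewrite sum_constr -/q /nn; field; rewrite !gt_eqF.
- by rewrite -(n2 (true, x.2) u y).
rewrite -mulr_sumr /shift_weight /=.
(* A given column is hit by exactly one of the q shifts. *)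
under eq_bigr => j _ do rewrite mulrC -subr_eq eq_sym.
by rewrite (sum_shift (fun=> q%:R)) -/q /nn; field; rewrite !gt_eqF.
Qed.

Lemma instance_sum G x : balanced G -> \sum_c instance_measure G x c = total_mass x.
Proof.
move=> [G0 [G1 G2]]; rewrite /instance_measure.
apply: (sum_umeasure dump_mass (m := fun u => unit_mass h l (x u))) => u.
rewrite sum_unit.
transitivity (\sum_(j < q) unit_mass h l (x u) / q%:R).
  apply: eq_bigr => j _; rewrite -(G1 _ u j) pair_big.
  by apply: eq_bigr => -[].
by rewrite sum_constr mulrC divfK // gt_eqF.
Qed.

Lemma instance_is_dist G x : balanced G -> is_dist (instance_dist G x).
Proof.
move=> bG; split=> [c|].
  rewrite ffunE divr_ge0 ?(ltW (total_mass_gt0 x)) // /instance_measure /umeasure.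
  by case: unit_of => [u|]; [case: bG | rewrite invr_ge0 mulr_ge0].
under eq_bigr do rewrite ffunE.
by rewrite -mulr_suml instance_sum // mulfV // gt_eqF // total_mass_gt0.
Qed.

Lemma prod_marginals G x : balanced G ->
  prod_dist (marginal1 (instance_dist G x)) (marginal2 (instance_dist G x)) =
  instance_dist (null_density h l) x.
Proof.
move=> [G0 [G1 G2]]; have T0 := total_mass_gt0 x.
have col y : marginal2 (instance_dist G x) y = (K%:R * q%:R)^-1.
  rewrite ffunE; under eq_bigr do rewrite ffunE.
  rewrite -mulr_suml (bigD1 None) //= (reindex_omap Some id) /=; last by case.
  rewrite (eq_bigl predT) => [|u]; last by rewrite eqxx.
  have -> : \sum_(a : 'I_U * 'I_q) instance_measure G x (Some a, y) =
     \sum_u unit_mass h l (x u) / (K%:R * q%:R).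
    under [RHS]eq_bigr => u _ do rewrite -(G2 _ u y).
    by rewrite pair_big; apply: eq_bigr => -[].
  rewrite -mulr_suml /instance_measure /umeasure /= /dump /total_mass.
  by rewrite -{1}[_^-1]mul1r -mulrDl mulrAC mulfV ?mul1r // gt_eqF.
apply/ffunP => -[a y]; rewrite [LHS]ffunE /= col !ffunE.
under eq_bigr do rewrite ffunE.
rewrite -mulr_suml /instance_measure /umeasure /=.
case: a => [[u j]|] /=.
  by rewrite G1 /null_density -/q; field; rewrite !gt_eqF.
rewrite sumr_const card_prod !card_ord /dump -[X in X / _ * _]mulr_natr natrM -/q.
by field; rewrite !gt_eqF.
Qed.

Lemma dependence_null x : dependence (instance_dist (null_density h l) x) = 0.
Proof.
rewrite /dependence prod_marginals; last exact: balanced_null.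
by rewrite /hellinger2 big1 ?mulr0 // => c _; rewrite subrr expr0n.
Qed.

Lemma dependence_alt x :
  dependence (instance_dist (alt_density h l) x) =
  (\sum_u (~~ (x u).1)%:R) * l / total_mass x * (1 - (Num.sqrt q%:R)^-1).
Proof.
have T0 := total_mass_gt0 x.
rewrite /dependence prod_marginals; last exact: balanced_alt.
rewrite /hellinger2 (partition_big (@unit_of U K q') predT) //= (bigD1 None) //=.
rewrite big1 ?add0r => [|c /eqP cN]; last first.
  by rewrite !ffunE /instance_measure /umeasure cN subrr expr0n.
rewrite (reindex_omap Some id) /=; last by case.
rewrite (eq_bigl predT) => [|u]; last by rewrite eqxx.
rewrite !mulr_suml mulr_sumr; apply: eq_bigr => u _.
have [x1|x1] := boolP (x u).1 => /=.
  rewrite big1 ?mulr0 ?mul0r // => c /eqP cu.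
  rewrite !ffunE /instance_measure /umeasure cu /null_density /alt_density.
  by rewrite /unit_mass x1 subrr expr0n.
set sq := Num.sqrt q%:R.
have sq0 : 0 < sq by rewrite sqrtr_gt0.
have sqE : sq ^+ 2 = q%:R by rewrite sqr_sqrtr // ltW.
set a := l / nn / total_mass x.
have a0 : 0 < a by rewrite !divr_gt0.
(* For w in {0, q}, sqrt w = w / sqrt q, so (sqrt w - 1)^2 is the affine function (1 - 2 / sqrt q) w
   + 1. *)
transitivity (2^-1 * \sum_(c : Cell | unit_of c == Some u)
     ((a * (1 - 2 / sq)) * shift_weight R (x u).2 c + a)).
  congr (_ * _); apply: eq_bigr => c /eqP cu.
  rewrite !ffunE /instance_measure /umeasure cu /null_density /alt_density /unit_mass (negbTE x1).
  rewrite mulrAC -/nn -/a [in X in X - _]mulrC sqrtrM; last first.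
    by rewrite /shift_weight; case: c.1 => [[? ?]|] //; rewrite mulr_ge0.
  rewrite -[X in _ - X]mul1r -mulrBl exprMn sqr_sqrtr; last exact: ltW.
  move: cu; rewrite /shift_weight; case: c => [[[v j]|] y] //= _.
  case: eqP => _; rewrite ?mulr1 ?mulr0 ?sqrtr0 -/q -/sq -?sqE; last by ring.
  by field; rewrite gt_eqF.
rewrite big_split /= (sum_unit_const K q' a u) sum_unit_shift -/nn /a.
by field; rewrite !gt_eqF.
Qed.

End HardInstances.

(** * Le Cam's method for the two mixtures *)

Section Indistinguishable.
Variables (R : realType) (U K q' N : nat).
Let q := q'.+1.
Let Cell := (option ('I_U * 'I_q) * ('I_K * 'I_q))%type.
Let Z := {ffun 'I_K -> 'I_q}.
Variables (p h l : R).

Hypothesis h_gt0 : 0 < h.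
Hypothesis l_gt0 : 0 < l.

Lemma iid_expect_instance G (x : {ffun 'I_U -> bool * Z}) (t : N.-tuple Cell -> R) :
  iid_expect (instance_dist h l G x) t * total_mass h l x ^+ N =
  \sum_s lik (instance_measure (R := R) G x) s * t s.
Proof.
rewrite /iid_expect mulr_suml; apply: eq_bigr => s _; rewrite mulrAC; congr (_ * _).
rewrite -[X in _ ^+ X]card_ord -prodr_const -big_split /=; apply: eq_bigr => i _.
by rewrite ffunE divfK // gt_eqF // total_mass_gt0.
Qed.

(** Averaged with tilted weights, the tester accepts with probability at least 2/3 under the null
    mixture and at most 1/3 + 1/10 under the alternative, where 1/10 accounts, by Markov's
    inequality, for more than J heavy units. The gap exceeds the 1/10 allowed by the chi-square
    bound. *)
Lemma mixture_indistinguishable (t : N.-tuple Cell -> R) (J : R) :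
  let x := N%:R * (l ^+ 2 / h) in
  (0 < K)%N -> 0 < p < 1 -> 0 < J ->
  x * q%:R <= 1 / 2 -> N%:R * h <= 1 / 2 ->
  (1 + 8 * x ^+ 2 * q%:R / (p * K%:R)) ^+ U <= 1 + 1 / 100 ->
  (2 * p) *+ U <= J / 10 ->
  (forall s, 0 <= t s <= 1) ->
  (forall y : {ffun 'I_U -> bool * Z},
     2 / 3 <= iid_expect (instance_dist h l (null_density h l) y) t) ->
  (forall y : {ffun 'I_U -> bool * Z}, \sum_u ((y u).1)%:R <= J ->
     2 / 3 <= iid_expect (instance_dist h l (alt_density h l) y) (fun s => 1 - t s)) ->
  False.
Proof.
move=> x K_gt0 p01 J0 xq Nh chi hv t01 T0 T1.
have p0 : 0 < p by case/andP: p01.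
have p1 : 0 < 1 - p by rewrite subr_gt0; case/andP: p01.
pose w (y : {ffun 'I_U -> bool * Z}) : R := \prod_u prior p (y u).
have w0 y : 0 < w y.
  apply: prodr_gt0 => u _; rewrite mulr_gt0 //; first by case: (y u).1.
  by rewrite invr_gt0 lt0r (card_shift_neq0 R K q') ler0n.
have tot0 y : 0 < total_mass h l y by exact: total_mass_gt0.
pose mixture : (bool * Z -> Cell -> R) -> N.-tuple Cell -> R :=
  mixlik (@unit_of U K q') (fun=> (K%:R * q%:R)^-1) (prior p).
pose Zt := mixpow (@prior R K q' p) (unit_mass h l) U N 1.
have Zt0 : 0 < Zt.
  rewrite /Zt /mixpow (bigD1 [ffun=> (true, [ffun=> ord0])]) //=.
  rewrite ltr_pwDl //; first by rewrite mulr_gt0 ?exprn_gt0 ?w0 ?tot0.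
  by apply: sumr_ge0 => y _; rewrite mulr_ge0 ?exprn_ge0 ?ltW ?w0 ?tot0.
have mixE G : \sum_s mixture G s * t s =
    \sum_y w y * (iid_expect (instance_dist h l G y) t * total_mass h l y ^+ N).
  under [RHS]eq_bigr do rewrite iid_expect_instance mulr_sumr.
  rewrite exchange_big; apply: eq_bigr => s _ /=.
  by rewrite mulr_suml; apply: eq_bigr => y _; rewrite mulrA.
have dist : \sum_s `|mixture (null_density h l) s - mixture (alt_density h l) s| <= Zt / 10.
  apply: (mixlik_dist (dump_mass R U q' K_gt0) (c2 := @chi_weight R K q' p)
     (m2 := @chi_mass R K q' h l)
     (G2 := @chi_density R U K q' h l)).
  - by move=> c; rewrite invr_gt0 mulr_gt0 ?ltr0n.
  - exact: sum_null_density.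
  - exact: sum_alt_density.
  - exact: sum_chi_density.
  - by move=> u s; exact: unit_null_gt0.
  - by move=> u s; exact: unit_chi_bound.
  by apply: (le_trans (mixpow_chi_le _ _ _ _ _ _)) => //; rewrite ler_wpM2r // ltW.
have null_ge : 2 / 3 * Zt <= \sum_s mixture (null_density h l) s * t s.
  rewrite mixE /Zt /mixpow mulr_sumr; apply: ler_sum => y _.
  rewrite [leLHS]mulrCA -/(total_mass h l y) -/(w y) ler_pM2l ?w0 // ler_pM2r ?exprn_gt0 ?tot0 //.
have alt_le : \sum_s mixture (alt_density h l) s * t s <= (1 / 3 + 1 / 10) * Zt.
  rewrite mixE.
  (* Markov's inequality in pointwise form: when more than J units are heavy, their number divided
     by J is already at least 1. *)
  apply: (@le_trans _ _ (\sum_y w y *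
    ((1 / 3 + (\sum_u ((y u).1)%:R) / J) * total_mass h l y ^+ N))).
    apply: ler_sum => y _; rewrite ler_pM2l // ler_pM2r ?exprn_gt0 //.
    set c := \sum_u _.
    have c0 : 0 <= c by apply: sumr_ge0.
    set f := iid_expect _ _.
    have Ef : iid_expect (instance_dist h l (alt_density h l) y) (fun s => 1 - t s) = 1 - f.
      by rewrite iid_expect_compl //; apply/instance_is_dist/balanced_alt.
    have [cJ|cJ] := leP c J.
      have := T1 y cJ; rewrite Ef => Hf.
      have : 0 <= c / J by rewrite divr_ge0 // ltW.
      lra.
    have : 1 <= c / J by rewrite ler_pdivlMr // mul1r ltW.
    have : 0 <= 1 - f.
      rewrite -Ef; apply: iid_expect_ge0; first exact/instance_is_dist/balanced_alt.
      by move=> s; case/andP: (t01 s) => _; rewrite subr_ge0.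
    lra.
  have cnt := prior_heavy_count U K q' p01 h_gt0 l_gt0 Nh.
  have -> : \sum_y w y * ((1 / 3 + (\sum_u ((y u).1)%:R) / J) * total_mass h l y ^+ N) =
    1 / 3 * Zt + J^-1 * \sum_(y : {ffun 'I_U -> bool * Z}) (\prod_u prior p (y u)) *
       (1 + \sum_u unit_mass h l (y u)) ^+ N * (\sum_u ((y u).1)%:R).
    rewrite /Zt /mixpow !mulr_sumr -big_split; apply: eq_bigr => y _ /=.
    by rewrite /w /total_mass; ring.
  rewrite mulrDl lerD2l.
  have -> : 1 / 10 * Zt = J^-1 * ((J / 10) * Zt) by field; rewrite gt_eqF.
  rewrite ler_pM2l ?invr_gt0 //; apply: (le_trans cnt).
  by rewrite ler_pM2r.
have diff : \sum_s mixture (null_density h l) s * t s -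
    \sum_s mixture (alt_density h l) s * t s <= Zt / 10.
  apply: (le_trans _ dist); rewrite -sumrB; apply: ler_sum => s _.
  have /andP[ts0 ts1] := t01 s.
  rewrite -mulrBl; set a := _ - _.
  have := ler_norm a; have := normr_ge0 a; nra.
lra.
Qed.

End Indistinguishable.

(** * Two-point and diagonal distributions *)

Lemma sum_bool2 (V : nmodType) (F : bool * bool -> V) :
  \sum_x F x = F (true, true) + F (true, false) + (F (false, true) + F (false, false)).
Proof.
transitivity (\sum_a \sum_b F (a, b)).
  by rewrite pair_big; apply: eq_bigr => -[].
by rewrite !big_bool.
Qed.

Section TwoPoint.
Variables (R : realType).

Definition two_point (e : R) : {ffun bool * bool -> R} :=
  [ffun x => if x == (false, false) then 1 - e else if x == (true, true) then e else 0].

Lemma two_point_is_dist e : 0 <= e <= 1 -> is_dist (two_point e).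
Proof.
move=> /andP[e0 e1]; split=> [x|].
  by rewrite ffunE; case: eqP => _; [rewrite subr_ge0 | case: eqP].
by rewrite sum_bool2 !ffunE /=; ring.
Qed.

Lemma dependence_two_point e : 0 <= e <= 1 ->
  dependence (two_point e) = 2^-1 * ((Num.sqrt e - e) ^+ 2 +
    (Num.sqrt (1 - e) - (1 - e)) ^+ 2) + e * (1 - e).
Proof.
move=> /andP[e0 e1]; rewrite /dependence /hellinger2.
have e1' : 0 <= 1 - e by rewrite subr_ge0.
rewrite sum_bool2 !ffunE !big_bool !ffunE /= !add0r !addr0.
rewrite -!expr2 !sqrtr_sqr !ger0_norm // !sqrtr0 !sub0r !sqrrN.
rewrite !sqr_sqrtr ?mulr_ge0 //. by field.
Qed.

(** All N samples are (false, false) with probability (1 - 2 eps)^N, and the tester then sees the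
    same as under a point mass. *)
Lemma two_point_bound eps dA dC N (t : N.-tuple ('I_dA * 'I_dC)%type -> R) :
  (1 < dC)%N -> (dC <= dA)%N -> 0 < eps <= 1 / 4 -> is_tester eps t ->
  1 <= 4 * eps * N%:R.
Proof.
move=> dC1 dCA /andP[eps0 eps4] /is_tester_embed H.
have [||t' [t01 tP]] := H bool bool; rewrite ?card_bool ?(leq_trans dC1) //.
have z01 : 0 <= (0 : R) <= 1 by rewrite lexx ler01.
have e01 : 0 <= 2 * eps <= 1 by lra.
pose s0 : N.-tuple (bool * bool) := [tuple (false, false) | _ < N].
have t0 : 2 / 3 <= t' s0.
  have [+ _] := tP _ (two_point_is_dist z01).
  rewrite dependence_two_point // !subr0 sqrtr0 sqrtr1 subrr !expr0n addr0 mulr0 mul0r addr0.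
  move=> /(_ erefl); rewrite /iid_expect (bigD1 s0) //= [X in _ + X]big1 ?addr0.
    by rewrite big1 ?mul1r // => i _; rewrite tnth_mktuple ffunE eqxx subr0.
  move=> s ss0; suff [i si] : exists i, tnth s i != (false, false).
    by rewrite (bigD1 i) //= ffunE (negbTE si) if_same !mul0r.
  apply/existsP; apply: contraNT ss0; rewrite negb_exists => /forallP s0E.
  apply/eqP/eq_from_tnth => i; rewrite tnth_mktuple.
  by have := s0E i; rewrite negbK => /eqP.
(* The off-diagonal cells alone contribute 2 eps (1 - 2 eps) >= eps. *)
have dep : eps <= dependence (two_point (2 * eps)).
  rewrite dependence_two_point //.
  set a := _ ^+ 2; set b := _ ^+ 2.
  have a0 : 0 <= a by exact: sqr_ge0.
  have b0 : 0 <= b by exact: sqr_ge0.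
  nra.
have dP := two_point_is_dist e01.
have [_ /(_ dep)] := tP _ dP; rewrite iid_expect_compl // => far.
have pow_le : (1 - 2 * eps) ^+ N * t' s0 <= iid_expect (two_point (2 * eps)) t'.
  rewrite /iid_expect (bigD1 s0) //= ler_wpDr //.
    apply: sumr_ge0 => s _; rewrite mulr_ge0 //; last by case/andP: (t01 s).
    by apply: prodr_ge0 => i _; case: dP.
  under eq_bigr do rewrite tnth_mktuple ffunE eqxx.
  by rewrite prodr_const card_ord.
have bern : 1 - 2 * eps * N%:R <= (1 - 2 * eps) ^+ N.
  apply: le_trans (bernoulli_ge N _); last by lra.
  by rewrite le_eqVlt; apply/orP; left; apply/eqP; ring.
nra.
Qed.

Lemma dependence_diagonal n :
  let P : {ffun 'I_n.+1 * 'I_n.+1 -> R} := [ffun x => (x.1 == x.2)%:R / n.+1%:R] in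
  is_dist P /\ dependence P = max_dependence R n.+1.
Proof.
move=> P.
have n0 : 0 < n.+1%:R :> R by rewrite ltr0n.
have E1 a : \sum_(c < n.+1) (a == c)%:R / n.+1%:R = n.+1%:R^-1 :> R.
  under eq_bigr do rewrite eq_sym.
  by rewrite (sum_shift (fun=> n.+1%:R^-1)).
have E2 a : \sum_(c < n.+1) (c == a)%:R / n.+1%:R = n.+1%:R^-1 :> R.
  by rewrite (sum_shift (fun=> n.+1%:R^-1)).
have m1 a : marginal1 P a = n.+1%:R^-1.
  by rewrite ffunE -(E1 a); apply: eq_bigr => c _; rewrite ffunE.
have m2 a : marginal2 P a = n.+1%:R^-1.
  by rewrite ffunE -(E2 a); apply: eq_bigr => c _; rewrite ffunE.
split.
  split=> [x|]; first by rewrite ffunE divr_ge0.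
  transitivity (\sum_a \sum_c P (a, c)).
    by rewrite pair_big; apply: eq_bigr => -[].
  have -> : \sum_a \sum_c P (a, c) = \sum_a marginal1 P a.
    by apply: eq_bigr => a _; rewrite ffunE.
  under eq_bigr do rewrite m1.
  by rewrite sum_constr mulfV // gt_eqF.
set r : R := Num.sqrt (n.+1%:R : R).
have r0 : 0 < r by rewrite sqrtr_gt0.
have rE : r ^+ 2 = n.+1%:R by rewrite sqr_sqrtr // ltW.
rewrite /dependence /hellinger2 /max_dependence -/r.
transitivity (2^-1 * \sum_(a < n.+1) \sum_(c < n.+1)
   ((c == a)%:R * (r ^- 2 - 2 * r ^- 3) + r ^- 4)).
  rewrite pair_big /=; congr (_ * _); apply: eq_bigr => -[a c] _.
  rewrite [in X in _ - X]ffunE m1 m2 ffunE /= -expr2 sqrtr_sqr ger0_norm; last by rewrite invr_ge0.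
  rewrite sqrtrM // sqrtrV // -/r -rE eq_sym.
  by case: eqP => _; rewrite ?sqrtr1 ?sqrtr0 /= ?mulr1n ?mulr0n; field; rewrite gt_eqF.
under eq_bigr do rewrite big_split /= (sum_shift (fun=> r ^- 2 - 2 * r ^- 3)) sum_constr.
by rewrite sum_constr -rE; field; rewrite gt_eqF.
Qed.

(** Without samples the answer does not depend on the distribution, yet the diagonal distribution is
    far and a point mass is independent. *)
Lemma no_tester_without_samples eps dA dC (t : 0.-tuple ('I_dA * 'I_dC)%type -> R) :
  (0 < dC)%N -> (dC <= dA)%N -> eps <= max_dependence R dC -> ~ is_tester eps t.
Proof.
case: dC t => // n t _ nA epsn tester_t.
have [||t' [t01 tP]] := is_tester_embed tester_t (A := 'I_n.+1) (C := 'I_n.+1);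
  rewrite ?card_ord //.
have [dP dE] := dependence_diagonal n.
have [_] := tP _ dP; rewrite dE => /(_ epsn).
rewrite iid_expect_compl // => far.
pose Q : {ffun unit * unit -> R} := [ffun=> 1].
pose F := fun _ : unit => ord0 : 'I_n.+1.
have FI : injective F by move=> [] [].
have dQ : is_dist Q.
  split=> [x|]; first by rewrite ffunE.
  by rewrite (big_pred1 (tt, tt)) ?ffunE // => -[[] []].
have [+ _] := tP _ (is_dist_push (fun x => (F x.1, F x.2)) dQ).
rewrite dependence_push //.
have -> : dependence Q = 0.
  rewrite /dependence /hellinger2 big1 ?mulr0 // => x _.
  rewrite !ffunE !(big_pred1 tt) ?ffunE; try by case.
  by rewrite mul1r subrr expr0n.
move=> /(_ erefl).
have E0 P : iid_expect P t' = \sum_s t' s.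
  by apply: eq_bigr => s _; rewrite big_ord0 mul1r.
by move: far; rewrite !E0; lra.
Qed.

(** For eps above 1/4 it is enough that N is not zero. *)
Lemma tester_size_ge eps dA dC N (t : N.-tuple ('I_dA * 'I_dC)%type -> R) :
  (1 < dC)%N -> (dC <= dA)%N -> 0 < eps -> eps <= max_dependence R dC ->
  is_tester eps t -> 1 <= 4 * eps * N%:R.
Proof.
move=> dC1 dCA eps0 epsm tester_t; have [eps4|eps4] := leP eps (1 / 4).
  by apply: (two_point_bound dC1 dCA _ tester_t); rewrite eps0.
case: N t tester_t => [|N] t tester_t.
  by case: (@no_tester_without_samples _ _ _ t (ltnW dC1) dCA epsm).
have : 1 <= N.+1%:R :> R by rewrite ler1n.
nra.
Qed.

End TwoPoint.

(** * Choice of parameters *)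

(** Here y is the light mass and a the heavy mass. From y >= 3 f / delta and 1 - f >= delta / 2
    follows y (1 - f) >= 3 f / 2 >= f (1 + a); hence the factor 6 / delta in the choice of the light
    mass. *)
Lemma light_fraction (R : realType) (delta f a y : R) :
  0 < delta < 1 -> 0 < f -> f <= 1 - delta / 2 -> 0 <= a <= 1 / 2 ->
  6 / delta * f / 2 <= y -> f <= y / (1 + a + y).
Proof.
move=> /andP[d0 d1] f0 fd /andP[a0 a2] yf.
have y0 : 0 < y by apply: lt_le_trans yf; rewrite !mulr_gt0 // invr_gt0.
rewrite ler_pdivlMr; last by lra.
have : 6 / delta * f / 2 * (delta / 2) <= y * (1 - f).
  apply: ler_pM => //; last by lra.
    by rewrite !mulr_ge0 // ?invr_ge0 ltW.
  by rewrite mulr_ge0 // ltW.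
have -> : 6 / delta * f / 2 * (delta / 2) = 3 / 2 * f by field; rewrite gt_eqF.
nra.
Qed.

(* The light mass of a unit is [R0 * f / U], the heavy mass [1 / (2 * N)], and a unit
   is heavy with probability [J / (20 * U)]. *)
Lemma chi_parameters (R : realType) (m n N U K q Q R0 f eps c J : R) :
  let x := N * ((R0 * f / U) ^+ 2 / (2 * N)^-1) in
  let W := 128 * Q ^+ 3 * R0 ^+ 2 in
  0 < n -> n <= m -> 1 <= N -> 0 < U -> U <= m -> m <= 2 * q * U ->
  0 < K -> n <= 2 * q * K -> 1 <= q -> q <= Q -> 1 <= R0 ->
  0 < eps -> 0 < f -> f <= 4 * eps ->
  0 < J -> J^-1 <= 2 / U + N^-1 ->
  0 < c -> 960 * W ^+ 2 * c <= 1 / 200 ->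
  (N * eps) ^+ 4 <= c ^+ 4 * (m ^+ 3 * n) ->
  N ^+ 3 * eps ^+ 4 <= c ^+ 3 * (m ^+ 2 * n) ->
  x * q <= 1 / 2 /\ U * (8 * x ^+ 2 * q / (J / (20 * U) * K)) <= 1 / 200.
Proof.
move=> x W n0 nm N1 U0 Um mU K0 nK q1 qQ R1 eps0 f0 f4 J0 Jinv c0 cW a b.
have N0 : 0 < N by lra.
have m0 : 0 < m by lra.
have q0 : 0 < q by lra.
have Q1 : 1 <= Q by lra.
have Q0 : 0 < Q by lra.
have R00 : 0 < R0 by lra.
have Q3 : 1 <= Q ^+ 3 by rewrite exprn_ege1.
have R2 : 1 <= R0 ^+ 2 by rewrite exprn_ege1.
have W1 : 1 <= W by rewrite /W; nra.
have W0 : 0 < W by lra.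
have W2 : W <= W ^+ 2 by rewrite expr2 ler_peMl // ltW.
have c1 : c <= 1.
  have : 1 * c <= W ^+ 2 * c by rewrite ler_pM2r //; lra.
  lra.
(* Up to constants, v is the expected number of light samples per row. *)
pose v := N * eps / m.
have v0 : 0 < v by rewrite /v divr_gt0 // mulr_gt0.
have [vge0 cge0 Uge0 mge0 qge0] : [/\ 0 <= v, 0 <= c, 0 <= U, 0 <= m & 0 <= q].
  by split; exact: ltW.
have [Qge0 Nge0 R0ge0 Kge0 Jge0] : [/\ 0 <= Q, 0 <= N, 0 <= R0, 0 <= K & 0 <= J].
  by split; exact: ltW.
have [fge0 nge0 Wge0 epsge0] : [/\ 0 <= f, 0 <= n, 0 <= W & 0 <= eps].
  by split; exact: ltW.
(* The two bounds on N in terms of v. They match the terms 2 m and m^2 / N that bound U^2 / J below: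
   x is at most of order v^2, so the chi-square excess is at most of order v^4 (m / n + m^2 / (n
   N)). *)
have v4 : v ^+ 4 * (m / n) <= c ^+ 4.
  have -> : v ^+ 4 * (m / n) = (N * eps) ^+ 4 / (m ^+ 3 * n).
    by rewrite /v; field; rewrite !gt_eqF.
  by rewrite ler_pdivrMr // mulr_gt0 // exprn_gt0.
have v3 : v ^+ 4 * (m ^+ 2 / (n * N)) <= c ^+ 3.
  have -> : v ^+ 4 * (m ^+ 2 / (n * N)) = N ^+ 3 * eps ^+ 4 / (m ^+ 2 * n).
    by rewrite /v; field; rewrite !gt_eqF.
  by rewrite ler_pdivrMr // mulr_gt0 // exprn_gt0.
have vc : v <= c.
  rewrite -(@ler_pXn2r _ 4) ?nnegrE //; apply: le_trans v4.
  by rewrite ler_peMr ?exprn_ge0 // ler_pdivlMr // mul1r.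
have Nl : N * (R0 * f / U) <= 8 * Q * R0 * v.
  have -> : N * (R0 * f / U) = R0 * N * (f / U) by field; rewrite gt_eqF.
  have -> : 8 * Q * R0 * v = R0 * N * (8 * Q * eps / m) by rewrite /v; field; rewrite gt_eqF.
  rewrite ler_pM2l ?mulr_gt0 // ler_pdivrMr // mulrAC ler_pdivlMr //.
  apply: (@le_trans _ _ (4 * eps * (2 * q * U))); first by apply: ler_pM => //; rewrite mulr_ge0.
  have : q * (eps * U) <= Q * (eps * U) by rewrite ler_pM2r // mulr_gt0.
  lra.
pose S := 128 * Q ^+ 2 * R0 ^+ 2.
have x0 : 0 <= x by rewrite /x mulr_ge0 ?mulr_ge0 ?sqr_ge0 ?invr_ge0 ?invr_ge0 ?mulr_ge0 // ltW.
have xS : x <= S * v ^+ 2.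
  have -> : x = 2 * (N * (R0 * f / U)) ^+ 2 by rewrite /x; field; rewrite !gt_eqF.
  have -> : S * v ^+ 2 = 2 * (8 * Q * R0 * v) ^+ 2 by rewrite /S; ring.
  by rewrite ler_pM2l //; apply: lerXn2r; rewrite ?nnegrE // !mulr_ge0 ?invr_ge0.
have S0 : 0 < S by rewrite /S !mulr_gt0 ?exprn_gt0.
have Sge0 : 0 <= S by exact: ltW.
split.
  apply: (@le_trans _ _ (S * c ^+ 2 * Q)).
    apply: ler_pM => //; apply: (le_trans xS); rewrite ler_pM2l //.
    by apply: lerXn2r; rewrite ?nnegrE.
  have -> : S * c ^+ 2 * Q = W * c ^+ 2 by rewrite /S /W; ring.
  apply: (@le_trans _ _ (W ^+ 2 * c)); last by lra.
  by apply: ler_pM; rewrite ?sqr_ge0 // expr2 ler_piMl.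
have Kinv : K^-1 <= 2 * Q / n.
  rewrite ler_pdivlMr // mulrC ler_pdivrMr //.
  have : q * K <= Q * K by rewrite ler_pM2r.
  lra.
have -> : U * (8 * x ^+ 2 * q / (J / (20 * U) * K)) =
   160 * (x ^+ 2 * q * K^-1 * (U ^+ 2 * J^-1)) by field; rewrite !gt_eqF.
have x2 : x ^+ 2 <= S ^+ 2 * v ^+ 4.
  have -> : S ^+ 2 * v ^+ 4 = (S * v ^+ 2) ^+ 2 by ring.
  by apply: lerXn2r; rewrite ?nnegrE // mulr_ge0 ?sqr_ge0.
have UJ : U ^+ 2 * J^-1 <= 2 * m + m ^+ 2 / N.
  apply: (@le_trans _ _ (U ^+ 2 * (2 / U + N^-1))).
    by rewrite ler_pM2l // exprn_gt0.
  have -> : U ^+ 2 * (2 / U + N^-1) = 2 * U + U ^+ 2 / N by field; rewrite !gt_eqF.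
  apply: lerD; first by rewrite ler_pM2l.
  by rewrite ler_pM2r ?invr_gt0 //; apply: lerXn2r; rewrite ?nnegrE.
have -> : 1 / 200 = 160 * (1 / (160 * 200)) :> R by field.
rewrite ler_pM2l //.
apply: (@le_trans _ _ (S ^+ 2 * v ^+ 4 * Q * (2 * Q / n) * (2 * m + m ^+ 2 / N))).
  have xx : 0 <= x ^+ 2 by exact: sqr_ge0.
  have xxq : 0 <= x ^+ 2 * q by exact: mulr_ge0.
  apply: ler_pM => //.
  - by apply: mulr_ge0; rewrite ?invr_ge0.
  - by apply: mulr_ge0; rewrite ?invr_ge0 ?sqr_ge0.
  apply: ler_pM => //.
  - by rewrite invr_ge0.
  exact: ler_pM.
have -> : S ^+ 2 * v ^+ 4 * Q * (2 * Q / n) * (2 * m + m ^+ 2 / N) =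
    W ^+ 2 * (4 * (v ^+ 4 * (m / n)) + 2 * (v ^+ 4 * (m ^+ 2 / (n * N)))).
  by rewrite /S /W; field; rewrite !gt_eqF.
have c3 : c ^+ 3 <= c by rewrite exprS ler_piMr // exprn_ile1.
have c4 : c ^+ 4 <= c by rewrite exprS ler_piMr // exprn_ile1.
apply: (@le_trans _ _ (W ^+ 2 * (6 * c))); last by lra.
by rewrite ler_pM2l ?exprn_gt0 //; lra.
Qed.

Lemma onePexp_small (R : realType) (X : R) n :
  0 <= X -> n%:R * X <= 1 / 200 -> (1 + X) ^+ n <= 1 + 1 / 100.
Proof.
move=> X0 nX; apply: (le_trans (exprD_le_expR n (lexx _) X0)).
rewrite expr1n mul1r; have nX2 : n%:R * X <= 1 / 2 by lra.
apply: (le_trans (expR_le_quadratic nX2)).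
have : 0 <= n%:R * X by rewrite mulr_ge0.
by move: nX; generalize (n%:R * X) => y; rewrite expr2; nra.
Qed.

Lemma ltn_double_div m q : (0 < q)%N -> (q <= m)%N -> (m < 2 * q * (m %/ q))%N.
Proof.
move=> q0 qm; apply: leq_trans (ltn_ceil m q0) _.
by rewrite mulSn -mulnA mul2n -addnn [(_ * q)%N]mulnC leq_add2r leq_pmulr // divn_gt0.
Qed.

Lemma invr_min_le (R : realFieldType) (a b : R) :
  0 < a -> 0 < b -> (Num.min a b)^-1 <= a^-1 + b^-1.
Proof.
move=> a0 b0; rewrite minEle.
by case: ifP => _; rewrite ?lerDl ?lerDr invr_ge0 ltW.
Qed.

(* The block size q = min dC Q makes 1 - q^(-1/2) comparable with [max_dependence]:
   it equals it when dC <= Q, and is at least 1 - delta / 2 otherwise. *)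
Lemma block_gap (R : realType) (delta eps : R) (Q n : nat) :
  0 < delta < 1 -> 4 <= Q%:R * delta ^+ 2 -> (1 < Q)%N -> (1 < n)%N ->
  0 < eps -> eps <= (1 - delta) * max_dependence R n ->
  let g := 1 - (Num.sqrt (minn n Q)%:R)^-1 in
  [/\ 0 < g, eps / g <= 4 * eps & eps / g <= 1 - delta / 2].
Proof.
move=> /andP[d0 d1] Qd Q1 n1 eps0 epsn g.
have q2 : 2 <= (minn n Q)%:R :> R by rewrite ler_nat leq_min n1 Q1.
set s := Num.sqrt (minn n Q)%:R in g *.
have s0 : 0 < s by rewrite sqrtr_gt0; lra.
have sE : s ^+ 2 = (minn n Q)%:R by rewrite sqr_sqrtr //; lra.
(* s^2 >= 2 > 16 / 9, hence g >= 1/4, the origin of the factor 4. *)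
have s43 : 4 / 3 <= s.
  rewrite leNgt; apply/negP => s43; have : s ^+ 2 < 2 by rewrite expr2; nra.
  by rewrite sE ltNge q2.
have g4 : 1 / 4 <= g.
  have : s^-1 <= 3 / 4 by rewrite invf_ple ?posrE ?divr_gt0 //; lra.
  by rewrite /g; lra.
have g0 : 0 < g by lra.
split=> //; first by rewrite ler_pdivrMr //; nra.
rewrite ler_pdivrMr //.
have gn : max_dependence R n <= 1 by rewrite gerBl invr_ge0 sqrtr_ge0.
have [nQ|Qn] := leqP n Q.
  apply: (le_trans epsn); rewrite /g /s (minn_idPl nQ) -/(max_dependence R n).
  rewrite ler_wpM2r //; last by lra.
  by move: g0; rewrite /g /s (minn_idPl nQ) => /ltW.
have gd : 1 - delta / 2 <= g.
  have : s^-1 <= delta / 2.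
    rewrite invf_ple ?posrE ?divr_gt0 //.
    rewrite -(@ler_pXn2r _ 2) ?nnegrE ?invr_ge0 ?divr_ge0 ?(ltW s0) ?(ltW d0) //.
    rewrite sE (minn_idPr (ltnW Qn)) invf_div expr_div_n ler_pdivrMr ?exprn_gt0 //.
    by apply: (le_trans _ Qd); rewrite expr2; lra.
  by rewrite /g; lra.
have : (1 - delta) * max_dependence R n <= 1 - delta by rewrite ler_piMr //; lra.
nra.
Qed.

(** The fraction of mass in light units enters the dependence with the factor g = 1 - q^(-1/2), so a
    fraction f = eps / g is aimed at. *)
Lemma large_alphabet (R : realType) (delta eps c : R) (Q dA dC N : nat)
    (t : N.-tuple ('I_dA * 'I_dC)%type -> R) :
  0 < delta < 1 -> 4 <= Q%:R * delta ^+ 2 -> (1 < Q)%N -> (Q < dA)%N -> (1 < dC)%N ->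
  (dC <= dA)%N -> (0 < N)%N -> 0 < eps -> eps <= (1 - delta) * max_dependence R dC ->
  0 < c -> 960 * (128 * Q%:R ^+ 3 * (6 / delta) ^+ 2) ^+ 2 * c <= 1 / 200 ->
  (N%:R * eps) ^+ 4 <= c ^+ 4 * (dA%:R ^+ 3 * dC%:R) ->
  N%:R ^+ 3 * eps ^+ 4 <= c ^+ 3 * (dA%:R ^+ 2 * dC%:R) ->
  ~ is_tester eps t.
Proof.
move=> d01 Qd Q1 QA C1 CA N0 eps0 epsm c0 cW a b tst.
have [d0 d1] := andP d01.
have [g0 f4 fd] := block_gap d01 Qd Q1 C1 eps0 epsm.
have qE : minn dC Q = (minn dC Q).-1.+1 by rewrite prednK // leq_min (ltnW C1) (ltnW Q1).
move: g0 f4 fd; rewrite qE; set q' := (minn dC Q).-1; set g := 1 - _; set f := eps / g.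
move=> g0 f4 fd.
have f0 : 0 < f by rewrite divr_gt0.
pose q := q'.+1.
have qC : (q <= dC)%N by rewrite /q -qE geq_minl.
have qQ : (q <= Q)%N by rewrite /q -qE geq_minr.
(* One row is set aside for the uniform row of mass 1, hence the predecessor of dA. *)
pose K := (dC %/ q)%N; pose U := (dA.-1 %/ q)%N.
have dA1 : (q <= dA.-1)%N by rewrite -ltnS prednK ?(leq_ltn_trans qQ) // (leq_ltn_trans _ QA).
have K0 : (0 < K)%N by rewrite divn_gt0.
have U0 : (0 < U)%N by rewrite divn_gt0.
have KC : (K * q <= dC)%N by rewrite leq_divM.
have UA : (U * q <= dA.-1)%N by rewrite leq_divM.
have CK : (dC <= 2 * q * K)%N.
  exact: ltnW (ltn_double_div (ltn0Sn q') qC).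
have AU : (dA <= 2 * q * U)%N.
  by rewrite -[leqLHS]prednK ?(leq_ltn_trans _ QA) //; exact: ltn_double_div dA1.
have UdA : (U <= dA)%N by rewrite (leq_trans (leq_div _ _)) ?leq_pred.
have [t' [t01 tP]] : exists t' : N.-tuple
    (option ('I_U * 'I_q) * ('I_K * 'I_q))%type -> R, (forall s, 0 <= t' s <= 1) /\
    forall P : {ffun _ -> R}, is_dist P ->
    (dependence P = 0 -> 2 / 3 <= iid_expect P t') /\
    (eps <= dependence P -> 2 / 3 <= iid_expect P (fun s => 1 - t' s)).
  apply: (is_tester_embed tst); rewrite ?card_option ?card_prod !card_ord //.
  by rewrite (leq_ltn_trans UA) // prednK // (leq_ltn_trans _ QA).
have rN : 1 <= N%:R :> R by rewrite ler1n.
have rU : 0 < U%:R :> R by rewrite ltr0n.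
have rN0 : 0 < N%:R :> R by rewrite ltr0n.
pose l : R := 6 / delta * f / U%:R.
pose h : R := (2 * N%:R)^-1.
(* J is the tolerated number of heavy units: J <= U / 2 leaves half of the units light, and J <= N
   keeps the heavy mass J h at most 1/2. The prior mean p U is J / 20, at most J / 10 after
   tilting. *)
pose J : R := Num.min (U%:R / 2) N%:R.
pose p : R := J / (20 * U%:R).
have l0 : 0 < l by rewrite !divr_gt0 ?mulr_gt0 ?divr_gt0 // invr_gt0.
have h0 : 0 < h by rewrite invr_gt0 mulr_gt0.
have J0 : 0 < J by rewrite lt_min rN0 divr_gt0.
have JU : J <= U%:R / 2 by rewrite ge_min lexx.
have JN : J <= N%:R by rewrite ge_min lexx orbT.
have p01 : 0 < p < 1.
  by rewrite divr_gt0 ?mulr_gt0 //= ltr_pdivrMr ?mulr_gt0 //; lra.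
have Jinv : J^-1 <= 2 / U%:R + N%:R^-1.
  by have := invr_min_le (divr_gt0 rU (ltr0Sn _ 1)) rN0; rewrite invf_div.
have R1 : 1 <= 6 / delta by rewrite ler_pdivlMr //; lra.
have [xq chi] := @chi_parameters R dA%:R dC%:R N%:R U%:R K%:R q%:R Q%:R (6 / delta) f eps c J
  ltac:(by rewrite ltr0n ltnW) ltac:(by rewrite ler_nat) rN rU ltac:(by rewrite ler_nat)
  ltac:(by rewrite -!natrM ler_nat) ltac:(by rewrite ltr0n) ltac:(by rewrite -!natrM ler_nat)
  ltac:(by rewrite ler1n) ltac:(by rewrite ler_nat) R1 eps0 f0 f4 J0 Jinv c0 cW a b.
have Nh : N%:R * h <= 1 / 2.
  by rewrite /h le_eqVlt; apply/orP; left; apply/eqP; field; rewrite gt_eqF.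
apply: (@mixture_indistinguishable R U K q' N p h l h0 l0 t' J) => //.
- apply: onePexp_small => //.
  rewrite divr_ge0 //; first by rewrite -mulrA mulr_ge0 // mulr_ge0 // sqr_ge0.
  by rewrite mulr_ge0 // ltW //; case/andP: p01.
- by rewrite le_eqVlt; apply/orP; left; apply/eqP; rewrite /p -mulr_natr; field; rewrite gt_eqF.
- move=> y; have [+ _] := tP _ (instance_is_dist K0 h0 l0 y (balanced_null U q' K0 h0 l0)).
  by apply; rewrite dependence_null.
move=> y yJ; have [_ +] := tP _ (instance_is_dist K0 h0 l0 y (balanced_alt U q' K0 h0 l0)).
apply; rewrite dependence_alt // -/g.
have -> : eps = f * g by rewrite /f divfK // gt_eqF.
rewrite ler_pM2r //.
set light := \sum_u (~~ _)%:R; set heavy := \sum_u _ in yJ.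
have lh : light + heavy = U%:R.
  rewrite /light /heavy -big_split /= (eq_bigr (fun=> 1)) ?sum_constr ?mulr1 // => u _.
  by case: (y u).1; rewrite /= ?add0r ?addr0.
have -> : total_mass h l y = 1 + heavy * h + light * l.
  rewrite /total_mass -addrA; congr (_ + _); rewrite !mulr_suml -big_split.
  apply: eq_bigr => u _; rewrite /unit_mass.
  by case: (y u).1; rewrite /= ?mul0r ?mul1r ?add0r ?addr0.
have heavy0 : 0 <= heavy by apply: sumr_ge0.
apply: (light_fraction d01 f0 fd).
  rewrite mulr_ge0 ?(ltW h0) //=.
  apply: (le_trans _ Nh); rewrite ler_pM2r //; lra.
have -> : 6 / delta * f / 2 = U%:R / 2 * l by rewrite /l; field; rewrite !gt_eqF.
rewrite ler_pM2r //; lra.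
Qed.

(** * The sample complexity lower bound *)

Lemma powR_exprn (R : realType) (a x : R) (k : nat) : (a `^ x) ^+ k = a `^ (x * k%:R).
Proof. by rewrite -powR_mulrn ?powR_ge0 // -powRrM. Qed.

(** Above [max_dependence] nothing is far, and always answering independent needs no samples; the
    constant c may depend on the relative margin delta below that threshold. Small dA is settled by
    1 <= 4 eps N, larger dA by [large_alphabet]. *)
Theorem theorem3 (R : realType) (delta : R) (hdelta : 0 < delta < 1) :
  exists (c : R) (k : nat), 0 < c /\
    forall (dA dC : nat) (eps : R),
      (0 < dC)%N -> (dC <= dA)%N -> 0 < eps < 1 ->
      eps <= (1 - delta) * max_dependence R dC ->
      ((c * SC_rate eps dA dC / log_factor eps dA dC ^+ k)%:E
         <= SC_IH eps dA dC)%E.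
Proof.
have [d0 d1] := andP hdelta.
(* Q >= 4 / delta^2 makes Q^(-1/2) <= delta / 2; the two successors also give Q >= 2. *)
pose Q := (Num.truncn (4 / delta ^+ 2)).+2.
have Qd : 4 <= Q%:R * delta ^+ 2.
  rewrite -ler_pdivrMr ?exprn_gt0 //.
  have := truncnS_gt (4 / delta ^+ 2); rewrite /Q -[X in _ <= X]natr1; lra.
pose W := 128 * Q%:R ^+ 3 * (6 / delta) ^+ 2.
have Q2 : 2 <= Q%:R :> R by rewrite ler_nat.
have R6 : 6 <= 6 / delta by rewrite ler_pdivlMr //; lra.
have WQ : Q%:R <= W.
  have Q3 : Q%:R <= Q%:R ^+ 3 :> R.
    by rewrite exprS ler_peMr // exprn_ege1 //; lra.
  have R2 : 1 <= (6 / delta) ^+ 2 by rewrite exprn_ege1 //; lra.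
  by rewrite /W; nra.
have W1 : 2 <= W by lra.
have W0 : 0 < W by lra.
pose D := 960 * (200 * W ^+ 2).
have D0 : 0 < D.
  have n0 n : 0 < n.+1%:R :> R by exact: ltr0Sn.
  by apply: mulr_gt0 (n0 _) _; apply: mulr_gt0 (n0 _) _; apply: exprn_gt0.
pose c := D^-1.
have c0 : 0 < c by rewrite invr_gt0.
have cW : 960 * W ^+ 2 * c <= 1 / 200.
  rewrite /c ler_pdivrMr // le_eqVlt; apply/orP; left; apply/eqP.
  by rewrite /D; field.
have cQ : c * Q%:R <= 1 / 4.
  rewrite mulrC ler_pdivrMr //; have WW : W <= W ^+ 2 by rewrite expr2 ler_peMl //; lra.
  by rewrite /D; lra.
(* The exponent is 0: no logarithmic factor is lost. *)
exists c, 0%N; split=> // dA dC eps dC0 dCA /andP[eps0 eps1] epsm.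
have C1 : (1 < dC)%N.
  (* With a single column [max_dependence] vanishes, leaving no room for eps > 0. *)
  rewrite ltnNge; apply/negP => dC1; move: epsm.
  have -> : dC = 1%N by apply/eqP; rewrite eqn_leq dC1.
  by rewrite /max_dependence sqrtr1 invr1 subrr mulr0 leNgt eps0.
rewrite expr0 divr1; apply/ereal_infP => _ [N [t tst] <-]; rewrite lee_fin.
have epsm' : eps <= max_dependence R dC.
  have m0 : 0 < max_dependence R dC.
    by have := lt_le_trans eps0 epsm; rewrite pmulr_rgt0 // subr_gt0.
  by apply: (le_trans epsm); rewrite ler_piMl ?(ltW m0) // gerBl ltW.
have N4 := tester_size_ge C1 dCA eps0 epsm' tst.
have N0 : (0 < N)%N.
  by rewrite lt0n; apply/eqP => N0; move: N4; rewrite N0 mulr0 lt_geF.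
rewrite leNgt; apply/negP => Nlt.
have rA : 0 < dA%:R :> R by rewrite ltr0n (leq_trans dC0).
have rC : 0 < dC%:R :> R by rewrite ltr0n.
have lt1 : N%:R * eps < c * (dA%:R `^ (3 / 4) * dC%:R `^ (1 / 4)).
  rewrite -ltr_pdivlMr // -mulrA; apply: (lt_le_trans Nlt).
  by rewrite ler_pM2l // /SC_rate ge_min lexx.
have lt2 : N%:R * eps `^ (4 / 3) < c * (dA%:R `^ (2 / 3) * dC%:R `^ (1 / 3)).
  rewrite -ltr_pdivlMr ?powR_gt0 // -mulrA; apply: (lt_le_trans Nlt).
  by rewrite ler_pM2l // /SC_rate ge_min lexx orbT.
(* For dA <= Q the first rate is at most Q / eps, and c Q <= 1/4 contradicts 1 <= 4 eps N. *)
have [AQ|QA] := leqP dA Q.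
  have : dA%:R `^ (3 / 4) * dC%:R `^ (1 / 4) <= dA%:R :> R.
    apply: (@le_trans _ _ (dA%:R `^ (3 / 4) * dA%:R `^ (1 / 4))).
      by rewrite ler_pM2l ?powR_gt0 // ge0_ler_powR ?nnegrE ?ler_nat.
    rewrite -powRD; last by rewrite (gt_eqF rA) implybT.
    have -> : 3 / 4 + 1 / 4 = 1 :> R by field.
    by rewrite powRr1.
  have : dA%:R <= Q%:R :> R by rewrite ler_nat.
  nra.
(* Fourth and third powers clear the fractional exponents of the two rates. *)
apply: (large_alphabet hdelta Qd _ QA C1 dCA N0 eps0 epsm c0 cW _ _ tst) => //.
  have -> : c ^+ 4 * (dA%:R ^+ 3 * dC%:R) =
      (c * (dA%:R `^ (3 / 4) * dC%:R `^ (1 / 4))) ^+ 4.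
    rewrite !exprMn !powR_exprn.
    have -> : 3 / 4 * 4%:R = 3%:R :> R by field.
    have -> : 1 / 4 * 4%:R = 1 :> R by field.
    by rewrite powR_mulrn // powRr1.
  by apply: lerXn2r; rewrite ?nnegrE ?mulr_ge0 ?powR_ge0 ?(ltW c0) ?(ltW eps0) ?(ltW lt1).
have -> : N%:R ^+ 3 * eps ^+ 4 = (N%:R * eps `^ (4 / 3)) ^+ 3.
  rewrite exprMn powR_exprn; have -> : 4 / 3 * 3%:R = 4%:R :> R by field.
  by rewrite powR_mulrn // ltW.
have -> : c ^+ 3 * (dA%:R ^+ 2 * dC%:R) =
    (c * (dA%:R `^ (2 / 3) * dC%:R `^ (1 / 3))) ^+ 3.
  rewrite !exprMn !powR_exprn.
  have -> : 2 / 3 * 3%:R = 2%:R :> R by field.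
  have -> : 1 / 3 * 3%:R = 1 :> R by field.
  by rewrite powR_mulrn // powRr1.
by apply: lerXn2r; rewrite ?nnegrE ?mulr_ge0 ?powR_ge0 ?(ltW c0) ?(ltW eps0) ?(ltW lt2).
Qed.
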